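(* Let $X:\Sigma^n\to\mathbb{R}^{n+m}$ be a complete $C$-soliton for the inverse mean curvature flow (IMCF) with respect to $\vec 0\in\mathbb{R}^{n+m}$ ($n\ge 1$). If $\Sigma$ is a parabolic manifold, then $X$ is a self-expander for the IMCF (i.e. $C>0$) and $$\frac1n\le C\le \frac1{n-2}.$$ Moreover, if $C=\frac1n$, then $X:\Sigma^n\to S^{n+m-1}(R)$ is minimal for some radius $R>0$ (that is, $X(\Sigma)\subseteq S^{n+m-1}(R)$ and $X$ is a minimal immersion into this sphere).
   Context: A complete isometric immersion $X:\Sigma^n\to\mathbb{R}^{n+m}$ of an $n$-dimensional Riemannian manifold is a $C$-soliton for the IMCF with respect to $\vec 0$ ($C\in\mathbb{R}$) if $\dfrac{\vec H}{\|\vec H\|^2}=-C X^\perp$ on $\Sigma$, where $\vec H$ is the mean curvature vector of $X$ (the trace of the second fundamental form, so $\vec H=\Delta^\Sigma X$), which must not vanish for the equation to make sense, and $X^\perp$ is the component of the position vector $X$ normal to $\Sigma$. It is a self-shrinker if $C<0$ and a self-expander if $C>0$. $S^{n+m-1}(R)$ is the sphere of radius $R$ centered at $\vec 0$ in $\mathbb{R}^{n+m}$. A complete Riemannian manifold $M$ is parabolic if every continuous subharmonic function $u:M\to\mathbb{R}$ ($\Delta u\ge 0$ when $u\in C^2$) with $\sup_M u<\infty$ is constant (compact manifolds have this property by the strong maximum principle).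
   Formalization: The upper bound C ≤ 1/(n−2) is stated only for n ≥ 3: for n = 2 it is undefined, and for n = 1 it would read C ≤ −1, which is false (the unit circle has C = 1); everything else holds for all n ≥ 1. *)

(* Defs.v *)
From HB Require Import structures.
From mathcomp Require Import all_boot all_order all_algebra.
From mathcomp Require Import all_classical all_reals all_analysis.
Set Implicit Arguments.
Unset Strict Implicit.
Unset Printing Implicit Defensive.
Import Order.TTheory GRing.Theory Num.Theory.
Import numFieldNormedType.Exports.
Local Open Scope classical_set_scope.
Local Open Scope ring_scope.

(* The norm that the library puts on row vectors is the sup norm; Euclidean
   quantities are always expressed through [dotp]. *)
Definition dotp (R : realType) (N : nat) (u v : 'rV[R]_N) : R :=
  \sum_(k < N) u 0 k * v 0 k.

Definition euclid_sphere (R : realType) (N : nat) (r : R) : set 'rV[R]_N :=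
  [set y | dotp y y = r ^+ 2].

Definition partial (R : realType) (n : nat) (V : normedModType R)
    (i : 'I_n) (f : 'rV[R]_n -> V) (q : 'rV[R]_n) : V :=
  'D_(delta_mx 0 i) f q.

(* C^k regularity on a set U, which is open in every use below. *)
Fixpoint Ck (R : realType) (n : nat) (V : normedModType R) (k : nat)
    (U : set 'rV[R]_n) (f : 'rV[R]_n -> V) : Prop :=
  match k with
  | 0 => forall q, U q -> {for q, continuous f}
  | k'.+1 => (forall q, U q -> differentiable f q) /\
             (forall i : 'I_n, Ck k' U (partial i f))
  end.

Definition smooth_on (R : realType) (n : nat) (V : normedModType R)
    (U : set 'rV[R]_n) (f : 'rV[R]_n -> V) : Prop :=
  forall k, Ck k U f.

(* Charts are total functions; only [chart_map] on [chart_dom] and [chart_inv]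
   on [chart_im] are meaningful. *)
Record chart (R : realType) (n : nat) (M : topologicalType) := Chart {
  chart_dom : set M;
  chart_map : M -> 'rV[R]_n;
  chart_inv : 'rV[R]_n -> M;
  chart_dom_open : open chart_dom;
  chart_im_open : open (chart_map @` chart_dom);
  chart_mapK : forall p, chart_dom p -> chart_inv (chart_map p) = p;
  chart_map_cont : forall p, chart_dom p -> {for p, continuous chart_map};
  chart_inv_cont : forall q, (chart_map @` chart_dom) q ->
                     {for q, continuous chart_inv} }.

Definition chart_im (R : realType) (n : nat) (M : topologicalType)
    (c : chart R n M) : set 'rV[R]_n := chart_map c @` chart_dom c.

Definition transition (R : realType) (n : nat) (M : topologicalType)
    (c d : chart R n M) : 'rV[R]_n -> 'rV[R]_n := chart_map d \o chart_inv c.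

Record smooth_manifold (R : realType) (n : nat) (M : topologicalType) :=
  SmoothManifold {
  atlas_idx : Type;
  atlas : atlas_idx -> chart R n M;
  atlas_cover : forall p, exists a, chart_dom (atlas a) p;
  atlas_smooth : forall a b,
    smooth_on (chart_map (atlas a) @`
                 (chart_dom (atlas a) `&` chart_dom (atlas b)))
              (transition (atlas a) (atlas b));
  manifold_hausdorff : hausdorff_space M;
  manifold_second_countable : @second_countable M;
  manifold_connected : connected [set: M];
  manifold_nonempty : [set: M] !=set0 }.

(* [metric a q] is the matrix (g_ij) at the point of coordinates q in the
   chart a.  The rows of the library's ['J f q] are the partial derivatives of
   f, whence the side of the transpose in the transformation law. *)
Record riemannian_metric (R : realType) (n : nat) (M : topologicalType)
    (S : smooth_manifold R n M) := RiemannianMetric {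
  metric : atlas_idx S -> 'rV[R]_n -> 'M[R]_n;
  metric_smooth : forall a i j,
    smooth_on (chart_im (atlas a)) (fun q => metric a q i j : R^o);
  metric_sym : forall a q, chart_im (atlas a) q ->
    (metric a q)^T = metric a q;
  metric_pos : forall a q (v : 'rV[R]_n), chart_im (atlas a) q -> v != 0 ->
    0 < (v *m metric a q *m v^T) 0 0;
  metric_change : forall a b p,
    chart_dom (atlas a) p -> chart_dom (atlas b) p ->
    let J := 'J (transition (atlas a) (atlas b)) (chart_map (atlas a) p) in
    metric a (chart_map (atlas a) p) =
      J *m metric b (chart_map (atlas b) p) *m J^T }.

Section Riemannian.
Variables (R : realType) (n : nat) (M : topologicalType).
Variables (S : smooth_manifold R n M) (g : riemannian_metric S).
Implicit Types (a : atlas_idx S) (q : 'rV[R]_n).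

Definition inv_metric a q : 'M[R]_n := invmx (metric g a q).

Definition metric_coef a (i j : 'I_n) q : R^o := metric g a q i j.

Definition christoffel a (k i j : 'I_n) q : R :=
  2^-1 * \sum_(l < n) inv_metric a q k l *
    (partial i (metric_coef a j l) q + partial j (metric_coef a i l) q
     - partial l (metric_coef a i j) q).

Definition hessian a (f : 'rV[R]_n -> R^o) (i j : 'I_n) q : R :=
  partial i (partial j f) q
  - \sum_(k < n) christoffel a k i j q * partial k f q.

Definition laplacian a (f : 'rV[R]_n -> R^o) q : R :=
  \sum_(i < n) \sum_(j < n) inv_metric a q i j * hessian a f i j q.

(* Subharmonicity of a continuous function, by comparison with harmonic
   functions.  Being a local property, it is tested on relatively compact open
   sets lying in a chart domain. *)
Definition subharmonic (u : M -> R^o) : Prop :=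
  forall a (Om : set M) (h : M -> R^o),
    open Om -> compact (closure Om) -> closure Om `<=` chart_dom (atlas a) ->
    {within closure Om, continuous h} ->
    Ck 2 (chart_map (atlas a) @` Om) (h \o chart_inv (atlas a)) ->
    (forall q, (chart_map (atlas a) @` Om) q ->
       laplacian a (h \o chart_inv (atlas a)) q = 0) ->
    (forall p, (closure Om `\` Om) p -> u p <= h p) ->
    forall p, Om p -> u p <= h p.

Definition parabolic : Prop :=
  forall u : M -> R^o, continuous u -> subharmonic u ->
    has_ubound (range u) -> exists k : R, forall p, u p = k.

Definition chart_speed a (s : R -> 'rV[R]_n) (t : R) : R :=
  Num.sqrt ((derive1 s t *m metric g a (s t) *m (derive1 s t)^T) 0 0).

(* [curve_of_length p r L]: some piecewise C^1 curve from p to r has length L.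
   Such a curve is cut into finitely many C^1 pieces, each parametrized by
   [0, 1] and contained in one chart domain. *)
Inductive curve_of_length : M -> M -> R -> Prop :=
| curve_nil p : curve_of_length p p 0
| curve_cons a (s : R -> 'rV[R]_n) (r : M) (L : R) :
    (forall t : R, derivable s t 1) -> continuous (derive1 s) ->
    (forall t : R, 0 <= t <= 1 -> chart_im (atlas a) (s t)) ->
    curve_of_length (chart_inv (atlas a) (s 1)) r L ->
    curve_of_length (chart_inv (atlas a) (s 0)) r
      (Rintegral lebesgue_measure `[0, 1] (chart_speed a s) + L).

Definition riem_dist (p r : M) : \bar R :=
  ereal_inf [set L%:E | L in curve_of_length p r].

Definition complete_metric : Prop :=
  forall u : nat -> M,
    (forall e : R, 0 < e -> exists N : nat, forall i j : nat,
       (N <= i)%N -> (N <= j)%N -> (riem_dist (u i) (u j) < e%:E)%E) ->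
    exists p : M, forall e : R, 0 < e -> exists N : nat, forall i : nat,
       (N <= i)%N -> (riem_dist (u i) p < e%:E)%E.

Section Immersion.
Variables (N : nat) (X : M -> 'rV[R]_N).

Definition param a : 'rV[R]_n -> 'rV[R]_N := X \o chart_inv (atlas a).

Definition isometric_immersion : Prop :=
  forall a, smooth_on (chart_im (atlas a)) (param a) /\
    forall q, chart_im (atlas a) q ->
      let J := 'J (param a) q in row_free J /\ J *m J^T = metric g a q.

(* Orthogonal projection of v onto the orthogonal complement of the tangent
   space, which is the row space of J. *)
Definition normal_part a q (v : 'rV[R]_N) : 'rV[R]_N :=
  let J := 'J (param a) q in v - v *m J^T *m invmx (J *m J^T) *m J.

Definition second_fund_form a (i j : 'I_n) q : 'rV[R]_N :=
  normal_part a q (partial i (partial j (param a)) q).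

Definition mean_curvature a q : 'rV[R]_N :=
  \sum_(i < n) \sum_(j < n) inv_metric a q i j *: second_fund_form a i j q.

Definition imcf_soliton (C : R) : Prop :=
  forall a q, chart_im (atlas a) q ->
    let H := mean_curvature a q in
    H != 0 /\ (dotp H H)^-1 *: H = - C *: normal_part a q (param a q).

Definition self_expander (C : R) : Prop := imcf_soliton C /\ 0 < C.

(* Projection onto the tangent space at x of the sphere centered at 0 through
   x; applied to Euclidean derivatives it gives the Levi-Civita connection of
   that sphere. *)
Definition sphere_tangent_part (x v : 'rV[R]_N) : 'rV[R]_N :=
  v - (dotp v x / dotp x x) *: x.

Definition sphere_second_fund_form a (i j : 'I_n) q : 'rV[R]_N :=
  normal_part a q
    (sphere_tangent_part (param a q) (partial i (partial j (param a)) q)).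

Definition sphere_mean_curvature a q : 'rV[R]_N :=
  \sum_(i < n) \sum_(j < n)
    inv_metric a q i j *: sphere_second_fund_form a i j q.

Definition minimal_in_sphere (r : R) : Prop :=
  (forall p, euclid_sphere r (X p)) /\
  (forall a q, chart_im (atlas a) q -> sphere_mean_curvature a q = 0).

End Immersion.
End Riemannian.

(* Main.v *)
(* Put s = |X|^2 and T = n - 1/C.  The soliton equation gives X^perp <> 0 and
   <X, H> = -1/C, whence s > 0 and Delta s = 2n + 2<X, H> = 2T, a constant,
   while |grad s|^2 = 4|X^T|^2 <= 4s.

   If T <= 0, then -s is subharmonic and bounded above, so s is constant and
   T = 0; for T = 0 this puts the image in a sphere, where the soliton equation
   reads H = -(n/|X|^2) X, i.e. minimality.  If T > 2, then -s^(-al) with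
   al + 1 = T/2 is subharmonic and bounded above, so again s is constant,
   against Delta s = 2T > 0.  Hence 0 <= T <= 2, which is everything except
   C > 0 when n = 1.  For curves, |grad s|^2 - 4Ts has zero derivative; if
   C < 0 then T > 1, so this function is bounded above by 0, hence a constant K
   by parabolicity, and K <= 4(1 - T)s bounds s from above, a contradiction.

   A C^2 function with nonnegative Laplacian is subharmonic in the comparison
   sense by the weak maximum principle: at an interior maximum of f the trace of
   the Hessian against g^-1 = B B^T is nonpositive, and u - h is made strictly
   subharmonic by adding a small multiple of exp(l q_i), with l large. *)
From mathcomp Require Import all_boot all_order all_algebra.
From mathcomp Require Import all_classical all_reals all_analysis.
From mathcomp Require Import ring lra.
Require Import Defs.
Set Implicit Arguments.
Unset Strict Implicit.
Unset Printing Implicit Defensive.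
Import Order.TTheory GRing.Theory Num.Theory.
Import numFieldNormedType.Exports.
Local Open Scope classical_set_scope.
Local Open Scope ring_scope.

(** * Continuity and partial derivatives *)

Section ContinuityAt.
Variables (R : realType) (T : topologicalType) (I : Type).
Implicit Types (f h : T -> R) (x : T).

Lemma continuous_at_mul f h x : {for x, continuous f} -> {for x, continuous h} ->
  {for x, continuous (fun y => f y * h y)}.
Proof. by move=> cf ch; exact: (cvgM cf ch). Qed.

Lemma continuous_at_sum (r : seq I) (P : pred I) (F : I -> T -> R) x :
  (forall i, {for x, continuous (F i)}) ->
  {for x, continuous (fun y => \sum_(i <- r | P i) F i y)}.
Proof.
by move=> cF; apply: cvg_big => [|i _]; [exact: add_continuous|exact: cF].
Qed.

Lemma continuous_at_prod (r : seq I) (P : pred I) (F : I -> T -> R) x :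
  (forall i, {for x, continuous (F i)}) ->
  {for x, continuous (fun y => \prod_(i <- r | P i) F i y)}.
Proof.
by move=> cF; apply: cvg_big => [|i _]; [exact: mul_continuous|exact: cF].
Qed.

End ContinuityAt.

Lemma continuous_at_dist (R : realType) (T : topologicalType) (f : T -> R) x (eps : R) :
  0 < eps -> {for x, continuous f} -> \forall y \near x, `|f x - f y| < eps.
Proof. by move=> eps0 cf; exact: (pseudometric_normed_Zmodule.cvgr_dist_lt _ _ cf _ eps0). Qed.

Lemma continuous_at_det (R : realType) (T : topologicalType) n
    (A : T -> 'M[R]_n) x :
  (forall i j, {for x, continuous (fun y => A y i j)}) ->
  {for x, continuous (fun y => \det (A y))}.
Proof.
move=> cA; rewrite /determinant; apply: continuous_at_sum => s.
apply: continuous_at_mul; first exact: cst_continuous.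
by apply: continuous_at_prod => i; exact: cA.
Qed.

Lemma continuous_at_inv (R : realType) (T : topologicalType) (f : T -> R) x :
  f x != 0 -> {for x, continuous f} -> {for x, continuous (fun y => (f y)^-1)}.
Proof. by move=> f0 cf; exact: (cvgV f0 cf). Qed.

Lemma continuous_at_near_eq (T U : topologicalType) (f h : T -> U) x :
  (\near x, f x = h x) -> {for x, continuous f} -> {for x, continuous h}.
Proof.
move=> fh cf; rewrite /prop_for /continuous_at -(nbhs_singleton fh).
exact: (cvg_trans (@near_eq_cvg _ _ (nbhs x) _ _ _ fh) cf).
Qed.

(** Cramer's rule makes the entries of the inverse rational in those of the matrix. It applies only
    where the matrix is invertible, since [invmx] returns a singular matrix unchanged. *)
Lemma continuous_at_invmx (R : realType) (T : topologicalType) n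
    (A : T -> 'M[R]_n) x i j :
  (forall k l, {for x, continuous (fun y => A y k l)}) ->
  (\near x, A x \in unitmx) ->
  {for x, continuous (fun y => invmx (A y) i j)}.
Proof.
move=> cA uA.
apply: (@continuous_at_near_eq _ _ (fun y => (\det (A y))^-1 * \adj (A y) i j)).
  by apply: filterS uA => y uy; rewrite /invmx uy !mxE.
apply: continuous_at_mul.
  apply: continuous_at_inv; last exact: continuous_at_det.
  by have := nbhs_singleton uA; rewrite unitmxE unitfE.
apply: (@continuous_at_near_eq _ _ (fun y => cofactor (A y) j i)).
  by apply: filterE => y; rewrite mxE.
apply: continuous_at_mul; first exact: cst_continuous.
apply: continuous_at_det => k l.
apply: (@continuous_at_near_eq _ _ (fun y => A y (lift j k) (lift i l))) => //.
by apply: filterE => y; rewrite !mxE.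
Qed.

(** Differentiability is an expansion f(y + q) = f(q) + df(y) + o(y), which depends only on the germ
    of the function at q. *)
Lemma differentiable_near (R : realType) (W V : normedModType R) (f g : W -> V) q :
  (\near q, f q = g q) -> differentiable f q -> differentiable g q.
Proof.
move=> fg /diff_locallyP[cd fo].
have go : g \o shift q = cst (g q) + 'd f q +o_ 0 id.
  apply/(@eqaddoP _ W V W) => e e0; move: fo => /(@eqaddoP _ W V W) /(_ _ e0) fo.
  have fg0 : \forall y \near 0, f (y + q) = g (y + q).
    by move: fg; rewrite (near_shift 0); apply: filterS => y; rewrite /= subr0.
  apply: filterS2 fo fg0 => y + fgy.
  by rewrite /= !fctE /= fgy (nbhs_singleton fg).
have dE := diff_unique cd go.
by apply/diff_locallyP; rewrite dE.
Qed.

Section PartialDerivatives.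
Variables (R : realType) (n : nat).
Implicit Types (U : set 'rV[R]_n) (q v : 'rV[R]_n) (i j : 'I_n).

Lemma derive_sum_partial (V : normedModType R) (f : 'rV[R]_n -> V) q v :
  differentiable f q -> 'D_v f q = \sum_i v 0 i *: partial i f q.
Proof.
move=> df; rewrite deriveE // [in LHS](row_sum_delta v) linear_sum /=.
by apply: eq_bigr => i _; rewrite linearZ /partial deriveE.
Qed.

Lemma eq_on_near (V : Type) U (f g : 'rV[R]_n -> V) q :
  open U -> {in U, f =1 g} -> U q -> \near q, f q = g q.
Proof.
move=> oU fg Uq; have : nbhs q U by apply: open_nbhs_nbhs.
by apply: filterS => x /mem_set; exact: fg.
Qed.

Lemma partial_coord N (f : 'rV[R]_n -> 'rV[R]_N) i (k : 'I_N) q :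
  differentiable f q ->
  partial i (fun x => f x 0 k : R^o) q = partial i f q 0 k.
Proof.
by move=> df; rewrite /partial [in RHS]derive_mx ?mxE //; apply: diff_derivable; exact: df.
Qed.

Lemma differentiable_coordE N (f : 'rV[R]_n -> 'rV[R]_N) (k : 'I_N) q :
  differentiable f q -> differentiable (fun x => f x 0 k : R^o) q.
Proof.
move=> df.
exact: (@differentiable_comp _ _ _ R^o f (fun y => y 0 k) q df
  (@differentiable_coord _ _ _ _ 0 k)).
Qed.

Lemma partialD (V : normedModType R) (f h : 'rV[R]_n -> V) i q :
  differentiable f q -> differentiable h q ->
  partial i (fun x => f x + h x) q = partial i f q + partial i h q.
Proof. by move=> df dh; apply: deriveD; exact: diff_derivable. Qed.

Lemma partialM (f h : 'rV[R]_n -> R^o) i q :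
  differentiable f q -> differentiable h q ->
  partial i (fun x => f x * h x : R^o) q = partial i f q * h q + f q * partial i h q.
Proof.
move=> df dh; rewrite /partial (_ : (fun x => _) = f * h) //.
rewrite deriveM; [|exact: diff_derivable|exact: diff_derivable].
by rewrite addrC; congr (_ + _); rewrite mulrC.
Qed.

Lemma partial_sum N (f : 'I_N -> 'rV[R]_n -> R^o) i q :
  (forall k, differentiable (f k) q) ->
  partial i (fun x => \sum_k f k x) q = \sum_k partial i (f k) q.
Proof.
move=> df; rewrite /partial (_ : (fun x => _) = \sum_k f k); last first.
  by apply/funext => x; rewrite fct_sumE.
by rewrite derive_sum // => k; exact: diff_derivable.
Qed.

Lemma differentiable_dotp N (f h : 'rV[R]_n -> 'rV[R]_N) q :
  differentiable f q -> differentiable h q ->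
  differentiable (fun x => dotp (f x) (h x) : R^o) q.
Proof.
move=> df dh; rewrite /dotp.
rewrite (_ : (fun x => _) =
    \sum_(k < N) ((fun x => f x 0 k : R^o) * (fun x => h x 0 k : R^o))).
  by apply: differentiable_sum => k; apply: differentiableM;
    exact: differentiable_coordE.
by apply/funext => x; rewrite fct_sumE.
Qed.

Lemma partial_dotp N (f h : 'rV[R]_n -> 'rV[R]_N) i q :
  differentiable f q -> differentiable h q ->
  partial i (fun x => dotp (f x) (h x) : R^o) q =
  dotp (partial i f q) (h q) + dotp (f q) (partial i h q).
Proof.
move=> df dh; rewrite /dotp partial_sum; last first.
  by move=> k; apply: differentiableM; exact: differentiable_coordE.
rewrite -big_split; apply: eq_bigr => k _ /=.
by rewrite partialM ?partial_coord //; exact: differentiable_coordE.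
Qed.

End PartialDerivatives.

(** * Calculus of functions of class C^k *)

Section CkTheory.
Variables (R : realType) (n : nat).
Implicit Types (U : set 'rV[R]_n) (q v : 'rV[R]_n) (i j : 'I_n) (k : nat).

Lemma Ck_ext (V : normedModType R) k U (f h : 'rV[R]_n -> V) :
  open U -> {in U, f =1 h} -> Ck k U f -> Ck k U h.
Proof.
move=> oU; elim: k f h => [|k IHk] f h fh /=.
  move=> cf q Uq.
  exact: (@continuous_at_near_eq 'rV[R]_n _ _ _ _ (eq_on_near oU fh Uq) (cf q Uq)).
move=> [df cf]; split=> [q Uq|i].
  apply: differentiable_near (df q Uq); exact: eq_on_near Uq.
apply: IHk (cf i) => q /set_mem Uq; apply: near_eq_derive; exact: eq_on_near Uq.
Qed.

Lemma Ck_continuous (V : normedModType R) U (f : 'rV[R]_n -> V) q k :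
  Ck k U f -> U q -> {for q, continuous f}.
Proof.
case: k => [|k] /=; first exact.
by move=> [df _] Uq; apply: differentiable_continuous; exact: df.
Qed.

Lemma Ck_pred (V : normedModType R) k U (f : 'rV[R]_n -> V) :
  Ck k.+1 U f -> Ck k U f.
Proof.
elim: k f => [|k IHk] f; first by move=> cf q; exact: Ck_continuous cf.
by move=> [df cf]; split=> // i; exact: IHk.
Qed.

Lemma Ck_sub (V : normedModType R) k U U' (f : 'rV[R]_n -> V) :
  U' `<=` U -> Ck k U f -> Ck k U' f.
Proof.
move=> UU'; elim: k f => [|k IHk] f /=; first by move=> cf q /UU'/cf.
by move=> [df cf]; split=> [q /UU'/df//|i]; exact: IHk.
Qed.

Lemma Ck_cst (V : normedModType R) k U (c : V) : Ck k U (fun _ => c).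
Proof.
elim: k c => [|k IHk] c /=; first by move=> q _; exact: cst_continuous.
split=> [q _|i]; first exact: differentiable_cst.
rewrite (_ : partial i _ = fun=> 0); first exact: IHk.
by apply/funext => q; exact: derive_cst.
Qed.

Lemma Ck_add (V : normedModType R) k U (f h : 'rV[R]_n -> V) :
  open U -> Ck k U f -> Ck k U h -> Ck k U (fun q => f q + h q).
Proof.
move=> oU; elim: k f h => [|k IHk] f h /=.
  by move=> cf ch q Uq; exact: (cvgD (cf q Uq) (ch q Uq)).
move=> [df cf] [dh ch]; split=> [q Uq|i].
  by apply: differentiableD; [exact: df|exact: dh].
apply: (Ck_ext oU _ (IHk _ _ (cf i) (ch i))) => q /set_mem Uq.
by rewrite partialD //; [exact: df|exact: dh].
Qed.

Lemma Ck_dotp N k U (f h : 'rV[R]_n -> 'rV[R]_N) :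
  open U -> Ck k U f -> Ck k U h -> Ck k U (fun q => dotp (f q) (h q) : R^o).
Proof.
move=> oU; elim: k f h => [|k IHk] f h.
  move=> cf ch q Uq.
  have cl (e : 'rV[R]_n -> 'rV[R]_N) l :
      {for q, continuous e} -> {for q, continuous (fun x => e x 0 l)}.
    by move=> ce; exact: (@continuous_comp _ _ _ e _ q ce (@coord_continuous _ _ _ 0 l (e q))).
  rewrite /dotp; apply: (@continuous_at_sum R 'rV[R]_n) => l.
  exact: (@continuous_at_mul R 'rV[R]_n _ _ _ (cl _ l (cf q Uq)) (cl _ l (ch q Uq))).
move=> /[dup] cfk [df cf] /[dup] chk [dh ch]; split=> [q Uq|i].
  by apply: differentiable_dotp; [exact: df|exact: dh].
have := Ck_add oU (IHk _ _ (cf i) (Ck_pred chk)) (IHk _ _ (Ck_pred cfk) (ch i)).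
apply: (Ck_ext oU) => q /set_mem Uq /=.
by rewrite partial_dotp //; [exact: df|exact: dh].
Qed.

Lemma Ck_mul k U (f h : 'rV[R]_n -> R^o) :
  open U -> Ck k U f -> Ck k U h -> Ck k U (fun q => f q * h q : R^o).
Proof.
move=> oU; elim: k f h => [|k IHk] f h.
  by move=> cf ch q Uq; exact: (cvgM (cf q Uq) (ch q Uq)).
move=> /[dup] cfk [df cf] /[dup] chk [dh ch]; split=> [q Uq|i].
  by apply: differentiableM; [exact: df|exact: dh].
have := Ck_add oU (IHk _ _ (cf i) (Ck_pred chk)) (IHk _ _ (Ck_pred cfk) (ch i)).
apply: (Ck_ext oU) => q /set_mem Uq /=.
by rewrite partialM //; [exact: df|exact: dh].
Qed.

Lemma Ck_coord k U (l : 'I_n) : Ck k U (fun q => q 0 l : R^o).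
Proof.
case: k => [|k]; first by move=> q _; exact: coord_continuous.
split=> [q _|i]; first exact: differentiable_coord.
rewrite (_ : partial i _ = fun=> (delta_mx 0 i : 'rV[R]_n) 0 l); first exact: Ck_cst.
apply/funext => q; rewrite (@partial_coord _ _ _ id); last by [].
by rewrite /partial derive_id.
Qed.

Lemma differentiable_comp1 (F : R -> R) (d : R) (f : 'rV[R]_n -> R^o) q :
  is_derive (f q) 1 F d -> differentiable f q ->
  differentiable (fun x => F (f x) : R^o) q.
Proof.
move=> [dF _] df.
have dF' : differentiable F (f q) by apply/derivable1_diffP.
exact: (@differentiable_comp _ _ _ R^o f F q df dF').
Qed.

Lemma partial_comp1 (F : R -> R) (d : R) (f : 'rV[R]_n -> R^o) i q :
  is_derive (f q) 1 F d -> differentiable f q ->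
  partial i (fun x => F (f x) : R^o) q = d * partial i f q.
Proof.
move=> /[dup] dF [dF1 dF2] df; rewrite /partial.
rewrite deriveE; last exact: differentiable_comp1 dF _.
have dF' : differentiable F (f q) by apply/derivable1_diffP.
rewrite (@diff_comp _ _ _ R^o f F q df dF') /= (deriveE _ df).
rewrite -dF2 -derive1E derive1E' // -[X in 'd F (f q) X = _]mulr1.
by rewrite [LHS]linearZ mulrC.
Qed.

(** The chain rule is applied twice, to [F] and to [F1]. Their derivatives are required only at
    values of [f], so that negative powers can be composed with positive functions. *)
Lemma C2_comp1 (F F1 F2 : R -> R) U (f : 'rV[R]_n -> R^o) :
  open U -> Ck 2 U f ->
  (forall q, U q -> is_derive (f q) 1 F (F1 (f q))) ->
  (forall q, U q -> is_derive (f q) 1 F1 (F2 (f q))) ->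
  (forall q, U q -> {for f q, continuous F2}) ->
  Ck 2 U (fun x => F (f x) : R^o).
Proof.
move=> oU [df cf] dF dF1 cF2; split=> [q Uq|i].
  by apply: differentiable_comp1 (dF q Uq) _; exact: df.
apply: (@Ck_ext _ _ _ (fun x => F1 (f x) * partial i f x : R^o)) => //.
  by move=> q /set_mem Uq; rewrite (partial_comp1 _ (dF q Uq)) //; exact: df.
apply: (@Ck_mul 1 U (fun x => F1 (f x) : R^o) (partial i f)) => //; split=> [q Uq|j].
  by apply: differentiable_comp1 (dF1 q Uq) _; exact: df.
apply: (@Ck_ext _ _ _ (fun x => F2 (f x) * partial j f x : R^o)) => //.
  by move=> q /set_mem Uq; rewrite (partial_comp1 _ (dF1 q Uq)) //; exact: df.
apply: (@Ck_mul 0 U (fun x => F2 (f x) : R^o) (partial j f)) => //; last first.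
  exact: (@Ck_pred _ 0 U (partial j f) (cf j)).
move=> q Uq.
exact: (@continuous_comp _ _ _ f F2 q (differentiable_continuous (df q Uq)) (cF2 q Uq)).
Qed.

Lemma line_is_derive (f : 'rV[R]_n -> R^o) q v t :
  differentiable f (q + t *: v) ->
  is_derive t 1 (fun x : R => f (q + x *: v)) ('D_v f (q + t *: v)).
Proof.
move=> df; have dl : differentiable (fun x : R^o => q + x *: v) t.
  by apply: differentiableD => //; exact: differentiableZl.
split.
  apply/derivable1_diffP.
  exact: (@differentiable_comp _ _ _ R^o (fun x : R^o => q + x *: v) f t dl df).
rewrite [LHS]deriveE; last first.
  exact: (@differentiable_comp _ _ _ R^o (fun x : R^o => q + x *: v) f t dl df).
rewrite (@diff_comp _ _ _ R^o (fun x : R^o => q + x *: v) f t dl df) /=.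
rewrite deriveE //; congr ('d f _ _).
rewrite -deriveE //; rewrite deriveD //; last first.
  by apply: diff_derivable; exact: differentiableZl.
rewrite derive_cst add0r deriveE; last exact: differentiableZl.
by rewrite diffZl //= diff_val scale1r.
Qed.

End CkTheory.

(** * Second-order calculus *)

Section SecondOrder.
Variable R : realType.

(** If c were positive, [dphi] would be positive just to the right of the critical point 0, and by
    the mean value theorem [phi] would exceed its maximum there. *)
Lemma second_derivative_at_max (phi dphi : R -> R) (r c : R) : 0 < r ->
  (forall t : R, `|t| < r -> is_derive t 1 phi (dphi t)) ->
  is_derive (0 : R) 1 dphi c -> (forall t, `|t| < r -> phi t <= phi 0) ->
  dphi 0 = 0 /\ c <= 0.
Proof.
move=> r0 dp ddp pmax.
have in_r t : t \in `](- r), r[ -> `|t| < r by rewrite in_itv /= ltr_norml.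
have d0 : dphi 0 = 0.
  have dp0 : is_derive (0 : R) 1 phi (dphi 0) by apply: dp; rewrite normr0.
  rewrite -(@derive_val _ _ _ _ _ _ _ dp0).
  apply: (@derive_val _ _ _ _ _ _ _ (@derive1_at_max _ phi (- r) r 0 _ _ _ _)).
  - by rewrite ge0_cp // ltW.
  - by move=> t /in_r /dp [].
  - by rewrite in_itv /= oppr_lt0 r0.
  - by move=> t /in_r; exact: pmax.
split=> //; rewrite leNgt; apply/negP => c0.
have [dd dc] := ddp.
have : (fun h : R => h^-1 *: (dphi (h *: 1 + 0) - dphi 0)) @ 0^' --> c.
  by rewrite -dc; exact: dd.
move=> /cvgr_gt /(_ 0 c0); rewrite near_withinE => /nbhs_ballP[e /= e0 He].
(* Small enough for both the neighbourhood where the difference quotient of [dphi] is positive and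
   the interval on which 0 is a maximum. *)
pose d := Num.min e r / 2.
have d0' : 0 < d by rewrite divr_gt0 // lt_min e0.
have dm : d < Num.min e r by rewrite /d ltr_pdivrMr // ltr_pMr ?ltr1n // lt_min e0.
have /andP[de dr] : (d < e) && (d < r) by rewrite -lt_min.
have dpos h : 0 < h -> h < e -> 0 < dphi h.
  move=> h0 he; have := He h; rewrite /= /ball /= sub0r normrN gtr0_norm // => /(_ he).
  rewrite gt_eqF // => /(_ isT); rewrite d0 subr0 addr0 [h *: 1]mulr1.
  by rewrite /GRing.scale /= pmulr_rgt0 // invr_gt0.
have [| | x /= xd] := @MVT _ phi dphi 0 d d0'.
- move=> x /[!in_itv] /= /andP[x0 xd]; apply: dp.
  by rewrite gtr0_norm // (lt_trans xd).
- apply: derivable_within_continuous => x /[!in_itv] /= /andP[x0 xd].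
  have [] // := dp x _.
  by rewrite ger0_norm // (le_lt_trans xd).
move: xd; rewrite in_itv /= => /andP[x0 xd] E.
have := pmax d; rewrite gtr0_norm // => /(_ dr); rewrite -subr_le0 E subr0 leNgt.
by rewrite mulr_gt0 // dpos // (lt_trans xd).
Qed.

Variable n : nat.
Implicit Types (U : set 'rV[R]_n) (q v : 'rV[R]_n) (i j : 'I_n).

Lemma open_line U q v : open U -> U q ->
  exists2 r : R, 0 < r & forall t : R, `|t| < r -> U (q + t *: v).
Proof.
move=> oU Uq; have /nbhs_ballP[e /= e0 He] : nbhs q U by apply: open_nbhs_nbhs.
exists (e / (1 + `|v|)); first by rewrite divr_gt0 // ltr_pwDl.
move=> t; rewrite ltr_pdivlMr ?ltr_pwDl // => te.
apply: He; rewrite -ball_normE /= opprD addrA subrr sub0r normrN normrZ.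
by apply: le_lt_trans te; rewrite ler_wpM2l // lerDr.
Qed.

(** Restricted to the line q + tv, [f] has a maximum at t = 0, and its second derivative there is
    the Hessian form at v. *)
Lemma partial_at_max U (f : 'rV[R]_n -> R^o) q :
  open U -> U q -> Ck 2 U f -> (forall x, U x -> f x <= f q) ->
  (forall i, partial i f q = 0) /\
  (forall v, \sum_i \sum_j v 0 i * v 0 j * partial i (partial j f) q <= 0).
Proof.
move=> oU Uq [df cf] fmax.
have key v : 'D_v f q = 0 /\
    \sum_i \sum_j v 0 i * v 0 j * partial i (partial j f) q <= 0.
  have [r r0 Ur] := open_line v oU Uq.
  have dfl (t : R) : `|t| < r -> is_derive t 1 (fun x : R => f (q + x *: v))
      (\sum_j v 0 j * partial j f (q + t *: v)).
    move=> /Ur/df dft; have := line_is_derive dft.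
    by rewrite derive_sum_partial.
  have ddfl : is_derive (0 : R) 1
      (fun t => \sum_j v 0 j * partial j f (q + t *: v))
      (\sum_i \sum_j v 0 i * v 0 j * partial i (partial j f) q).
    have dj j : is_derive (0 : R) 1 (fun t => v 0 j * partial j f (q + t *: v))
        (\sum_i v 0 i * v 0 j * partial i (partial j f) q).
      have dpj : differentiable (partial j f) (q + 0 *: v).
        by rewrite scale0r addr0; case: (cf j) => d _; exact: d.
      have := @is_deriveZ _ _ _ _ (v 0 j) _ _ _ (line_is_derive dpj).
      rewrite derive_sum_partial // scale0r addr0 scaler_sumr.
      congr is_derive; apply: eq_bigr => i _.
      by rewrite /GRing.scale /= mulrCA mulrA.
    rewrite exchange_big /=.
    have := @is_derive_sum _ _ _ n _ _ _ _ dj.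
    by congr is_derive; apply/funext => t; rewrite fct_sumE.
  have [|] := second_derivative_at_max r0 dfl ddfl.
    by move=> t /Ur Ut; rewrite scale0r addr0; exact: fmax.
  rewrite scale0r addr0 => d0 c0; split=> //.
  by rewrite derive_sum_partial //; exact: df.
by split=> [i|v]; [exact: (key (delta_mx 0 i)).1|exact: (key v).2].
Qed.

End SecondOrder.

(** * Symmetry of second partial derivatives *)

Section MixedPartials.
Variables (R : realType) (n : nat).
Implicit Types (U : set 'rV[R]_n) (q : 'rV[R]_n) (i j : 'I_n).

Local Notation e := (delta_mx 0).

Lemma MVT_derive (f df : R -> R) (t : R) : 0 < t ->
  (forall x : R, 0 <= x <= t -> is_derive x 1 f (df x)) ->
  exists2 c, 0 < c < t & f t - f 0 = df c * t.
Proof.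
move=> t0 fd; have [x | |c ct ->] := @MVT _ f df 0 t t0.
- by rewrite in_itv /= => /andP[/ltW x0 /ltW xt]; apply: fd; rewrite x0.
- apply: derivable_within_continuous => x; rewrite in_itv /= => /fd [] //.
- by exists c; [rewrite in_itv in ct|rewrite subr0].
Qed.

(** The mean value theorem is used twice: in direction i for the difference of [f] along two
    parallel segments, then in direction j for the partial derivative so obtained. *)
Lemma mixed_difference U (f : 'rV[R]_n -> R^o) q i j (t : R) :
  Ck 2 U f -> 0 < t ->
  (forall c d : R, 0 <= c <= t -> 0 <= d <= t -> U (q + c *: e i + d *: e j)) ->
  exists c d : R, [/\ 0 < c < t, 0 < d < t &
    f (q + t *: e i + t *: e j) - f (q + t *: e i) - (f (q + t *: e j) - f q) =
    partial j (partial i f) (q + c *: e i + d *: e j) * (t * t)].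
Proof.
move=> [df cf] t0 Ut.
have t0t : 0 <= t <= t by rewrite ltW /=.
have z0t : 0 <= (0:R) <= t by rewrite lexx ltW.
pose g (x : R) := f (q + t *: e j + x *: e i) - f (q + x *: e i).
have [x xt|c ct gE] := @MVT_derive g
    (fun x => partial i f (q + t *: e j + x *: e i) - partial i f (q + x *: e i)) t t0.
  apply: is_deriveB; apply: line_is_derive; apply: df.
    by rewrite addrAC; apply: Ut.
  by have := Ut x 0 xt z0t; rewrite scale0r addr0.
have /andP[/ltW c0 /ltW c1] := ct.
have [y yt|d dt hE] := @MVT_derive (fun y : R => partial i f (q + c *: e i + y *: e j))
    (fun y => partial j (partial i f) (q + c *: e i + y *: e j)) t t0.
  apply: line_is_derive; case: (cf i) => d _; apply: d; apply: Ut => //.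
  by rewrite c0.
exists c, d; split=> //.
rewrite mulrA -hE scale0r addr0 (addrAC q (c *: _)) -gE /g !scale0r !addr0.
by rewrite (addrAC q (t *: e j)); ring.
Qed.

(** The second difference of [f] over a small parallelogram is symmetric in i and j, so the two
    mixed partials agree when taken at suitable points near q; continuity carries the equality to
    q. *)
Lemma partialC U (f : 'rV[R]_n -> R^o) q i j :
  open U -> Ck 2 U f -> U q -> partial i (partial j f) q = partial j (partial i f) q.
Proof.
move=> oU cf Uq; apply/eqP; rewrite -subr_eq0 -normr_le0.
apply/ler_addgt0Pl => eps eps0; rewrite addr0.
have near_partial k l : \forall x \near q,
    `|partial k (partial l f) q - partial k (partial l f) x| < eps / 2.
  have cc : {for q, continuous (partial k (partial l f))}.
    by case: cf => _ /(_ l) [_ /(_ k)]; exact.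
  by apply: (@continuous_at_dist R 'rV[R]_n) cc; rewrite divr_gt0.
have oq : nbhs q U by apply: open_nbhs_nbhs.
have := filterI oq (filterI (near_partial i j) (near_partial j i)).
rewrite nbhs_ballP => -[r /= r0 Hr].
pose N := 1 + `|e i : 'rV[R]_n| + `|e j : 'rV[R]_n|.
have N0 : 0 < N by rewrite /N -addrA ltr_pwDl // addr_ge0.
(* Every point of the parallelogram with side parameter t lies within t * N of q, hence in the
   ball. *)
have [t t0 tr] : exists2 t, 0 < t & t * N < r.
  exists (r / N / 2); first by rewrite !divr_gt0.
  by rewrite mulrAC divfK ?gt_eqF // ltr_pdivrMr // ltr_pMr // ltr1n.
have inB (k l : 'I_n) (c d : R) :
    `|e k : 'rV[R]_n| + `|e l : 'rV[R]_n| <= N -> 0 <= c <= t -> 0 <= d <= t ->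
    ball q r (q + c *: e k + d *: e l).
  move=> klN /andP[c0 ct] /andP[d0 dt].
  rewrite -ball_normE /= -addrA opprD addrA subrr sub0r normrN.
  apply: le_lt_trans tr; apply: le_trans (ler_normD _ _) _.
  rewrite !normrZ !ger0_norm //.
  apply: le_trans (_ : t * (`|e k : 'rV[R]_n| + `|e l : 'rV[R]_n|) <= _); last first.
    by rewrite ler_wpM2l // ltW.
  by rewrite mulrDr lerD // ler_wpM2r.
have Nij : `|e i : 'rV[R]_n| + `|e j : 'rV[R]_n| <= N by rewrite /N -addrA lerDr.
have Nji : `|e j : 'rV[R]_n| + `|e i : 'rV[R]_n| <= N by rewrite addrC.
have [c d c0 d0|c [d [/andP[c0 ct] /andP[d0 dt] E1]]] :=
  mixed_difference (q := q) (i := i) (j := j) cf t0.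
  by have [] := Hr _ (inB i j c d Nij c0 d0).
have [c' d' c0' d0'|c' [d' [/andP[c0' ct'] /andP[d0' dt'] E2]]] :=
  mixed_difference (q := q) (i := j) (j := i) cf t0.
  by have [] := Hr _ (inB j i c' d' Nji c0' d0').
have cb : 0 <= c <= t by rewrite !ltW.
have db : 0 <= d <= t by rewrite !ltW.
have cb' : 0 <= c' <= t by rewrite !ltW.
have db' : 0 <= d' <= t by rewrite !ltW.
have [_ [_ /=]] := Hr _ (inB i j c d Nij cb db).
have [_ [/= + _]] := Hr _ (inB j i c' d' Nji cb' db').
have -> : partial i (partial j f) (q + c' *: e j + d' *: e i) =
    partial j (partial i f) (q + c *: e i + d *: e j).
  have tt0 : t * t != 0 by apply: mulf_neq0; rewrite gt_eqF.
  apply: (mulIf tt0); rewrite -[LHS]E2 -[RHS]E1 (addrAC q (t *: e j)).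
  by rewrite !opprB !addrA; ring.
(* [D] is the common value at the two intermediate points; each mixed partial at q is within eps / 2
   of it. *)
move: (partial i _ q) (partial j _ q) (partial j _ _) => A B D HA HB.
rewrite -[leLHS](_ : `|(A - D) - (B - D)| = _); last by congr `|_|; ring.
by rewrite (le_trans (ler_normB _ _)) // (splitr eps) lerD // ltW.
Qed.

End MixedPartials.

(** * The Laplacian in a chart *)

Section Laplacian.
Variables (R : realType) (n : nat) (M : topologicalType).
Variables (S : smooth_manifold R n M) (g : riemannian_metric S).
Implicit Types (a : atlas_idx S) (q : 'rV[R]_n) (U : set 'rV[R]_n).

Lemma partial_cst (V : normedModType R) (c : V) (i : 'I_n) q :
  partial i (fun _ => c) q = 0.
Proof. exact: derive_cst. Qed.

Lemma partialDZ (f h : 'rV[R]_n -> R^o) (c : R) i q :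
  differentiable f q -> differentiable h q ->
  partial i (fun x => f x + c * h x : R^o) q = partial i f q + c * partial i h q.
Proof.
move=> df dh; have dc := @differentiable_cst _ _ R^o c q.
rewrite (partialD i df (differentiableM dc dh)) (partialM i dc dh).
by rewrite partial_cst mul0r add0r.
Qed.

Lemma partial2DZ U (f h : 'rV[R]_n -> R^o) (c : R) i j q : open U -> U q ->
  Ck 2 U f -> Ck 2 U h ->
  partial i (partial j (fun x => f x + c * h x : R^o)) q =
  partial i (partial j f) q + c * partial i (partial j h) q.
Proof.
move=> oU Uq [df cf] [dh ch].
rewrite -(partialDZ c i (proj1 (cf j) q Uq) (proj1 (ch j) q Uq)).
apply: near_eq_derive; apply: (eq_on_near oU) Uq => x /set_mem Ux.
by rewrite partialDZ //; [exact: df|exact: dh].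
Qed.

Lemma laplacianDZ a U (f h : 'rV[R]_n -> R^o) (c : R) q : open U -> U q ->
  Ck 2 U f -> Ck 2 U h ->
  laplacian g a (fun x => f x + c * h x) q =
  laplacian g a f q + c * laplacian g a h q.
Proof.
move=> oU Uq cf ch; rewrite /laplacian mulr_sumr -big_split.
apply: eq_bigr => i _ /=; rewrite mulr_sumr -big_split; apply: eq_bigr => j _ /=.
rewrite mulrCA -mulrDr; congr (_ * _); rewrite /hessian (partial2DZ c i j oU Uq cf ch).
rewrite mulrBr mulr_sumr addrACA; congr (_ + _).
rewrite -opprD -big_split; congr (- _); apply: eq_bigr => k _ /=.
rewrite partialDZ; [|by case: cf => df _; exact: df|by case: ch => dh _; exact: dh].
by rewrite mulrDr mulrCA.
Qed.

Lemma laplacian_cst a (c : R) q : laplacian g a (fun _ => c) q = 0.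
Proof.
rewrite /laplacian big1 // => i _; rewrite big1 // => j _.
rewrite /hessian (_ : partial j _ = fun=> 0); last first.
  by apply/funext => x; exact: partial_cst.
rewrite partial_cst big1 ?subrr ?mulr0 // => k _.
by rewrite partial_cst mulr0.
Qed.

Definition grad_sq a (f : 'rV[R]_n -> R^o) q : R :=
  \sum_i \sum_j inv_metric g a q i j * (partial i f q * partial j f q).

(** The Christoffel terms all carry [F1]; only the second derivatives contribute a term in [F2].
    Used with an exponential for the barrier of the maximum principle and with a negative power for
    |X|^2. *)
Lemma laplacian_comp1 a U (f : 'rV[R]_n -> R^o) (F F1 F2 : R -> R) q :
  open U -> U q -> Ck 2 U f ->
  (forall x, U x -> is_derive (f x) 1 F (F1 (f x))) ->
  is_derive (f q) 1 F1 (F2 (f q)) ->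
  laplacian g a (fun x => F (f x)) q =
  F1 (f q) * laplacian g a f q + F2 (f q) * grad_sq a f q.
Proof.
move=> oU Uq [df cf] dF dF1; rewrite /laplacian /grad_sq !mulr_sumr -big_split.
apply: eq_bigr => i _ /=; rewrite !mulr_sumr -big_split; apply: eq_bigr => j _ /=.
rewrite [F1 _ * _]mulrCA [F2 _ * _]mulrCA -mulrDr; congr (_ * _); rewrite /hessian.
have -> : partial i (partial j (fun x => F (f x) : R^o)) q =
    partial i (fun x => F1 (f x) * partial j f x : R^o) q.
  apply: near_eq_derive; apply: (eq_on_near oU) Uq => x /set_mem Ux.
  by rewrite (partial_comp1 j (dF x Ux)) //; exact: df.
have dpj : differentiable (partial j f) q by case: (cf j) => d _; exact: d.
rewrite (partialM i (differentiable_comp1 dF1 (df q Uq)) dpj).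
rewrite (partial_comp1 i dF1 (df q Uq)) mulrBr mulr_sumr.
under eq_bigr => k _ do rewrite (partial_comp1 k (dF q Uq) (df q Uq)) mulrCA.
by ring.
Qed.

Lemma metric_unit a q : chart_im (atlas a) q -> metric g a q \in unitmx.
Proof.
move=> Uq; rewrite unitmxE unitfE; apply/det0P => -[v v0 vG].
by have := metric_pos g Uq v0; rewrite vG mul0mx mxE ltxx.
Qed.

Lemma open_chart_im a : open (chart_im (atlas a)).
Proof. exact: chart_im_open. Qed.

(** First derivatives vanish at the maximum, so the Christoffel terms drop out; the factorization
    turns the rest into a sum of Hessian forms at the columns of [B], each nonpositive. *)
Lemma laplacian_at_max a U (f : 'rV[R]_n -> R^o) q N (B : 'M[R]_(n, N)) :
  inv_metric g a q = B *m B^T -> open U -> U q -> Ck 2 U f ->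
  (forall x, U x -> f x <= f q) -> laplacian g a f q <= 0.
Proof.
move=> GB oU Uq cf fmax; have [d0 d2] := partial_at_max oU Uq cf fmax.
have -> : laplacian g a f q =
    \sum_k \sum_i \sum_j B i k * B j k * partial i (partial j f) q.
  rewrite exchange_big; apply: eq_bigr => i _.
  rewrite exchange_big; apply: eq_bigr => j _.
  rewrite GB mxE mulr_suml; apply: eq_bigr => k _.
  rewrite mxE /hessian big1 ?subr0 // => l _.
  by rewrite d0 mulr0.
apply: sumr_le0 => k _; have := d2 (\row_i B i k); congr (_ <= _).
by apply: eq_bigr => i _; apply: eq_bigr => j _; rewrite !mxE.
Qed.

Section Immersion.
Variables (N : nat) (X : M -> 'rV[R]_N).
Hypothesis Xiso : isometric_immersion g X.

Lemma param_Ck a k : Ck k (chart_im (atlas a)) (param X a).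
Proof. by case: (Xiso a) => sX _; exact: sX. Qed.

Lemma param_diff a q : chart_im (atlas a) q -> differentiable (param X a) q.
Proof. by move=> Uq; case: (param_Ck a 1) => d _; exact: d. Qed.

Lemma partial_row a i q : chart_im (atlas a) q ->
  partial i (param X a) q = row i ('J (param X a) q).
Proof.
by move=> Uq; rewrite /partial deriveEjacobian ?rowE //; exact: param_diff.
Qed.

Lemma dotpE (u v : 'rV[R]_N) : dotp u v = (u *m v^T) 0 0.
Proof. by rewrite mxE; apply: eq_bigr => k _; rewrite mxE. Qed.

Lemma metric_jac a q : chart_im (atlas a) q ->
  metric g a q = 'J (param X a) q *m ('J (param X a) q)^T.
Proof. by move=> Uq; case: (Xiso a) => _ /(_ q Uq) [_ <-]. Qed.

Lemma metric_dotp a i j q : chart_im (atlas a) q ->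
  metric g a q i j = dotp (partial i (param X a) q) (partial j (param X a) q).
Proof.
move=> Uq; rewrite metric_jac // !partial_row // mxE.
by apply: eq_bigr => k _; rewrite !mxE.
Qed.

(** From G = J J^T one gets G^-1 = G^-1 G G^-1 = (G^-1 J) (G^-1 J)^T: the immersion supplies the
    factor used in [laplacian_at_max], without a matrix square root. *)
Lemma inv_metric_factor a q : chart_im (atlas a) q ->
  let B := inv_metric g a q *m 'J (param X a) q in inv_metric g a q = B *m B^T.
Proof.
move=> Uq /=; rewrite trmx_mul mulmxA -(mulmxA _ ('J _ _)) -metric_jac //.
rewrite /inv_metric mulVmx ?metric_unit // mul1mx trmx_inv.
by rewrite metric_sym.
Qed.

End Immersion.
End Laplacian.

Lemma is_derive_expRM (R : realType) (l x : R) :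
  is_derive x 1 (fun x => expR (l * x)) (l * expR (l * x)).
Proof.
have dl : is_derive x 1 ( *%R l : R -> R) l.
  have := @is_deriveZ R R^o R^o id l x 1 1 (is_derive_id _ _).
  by congr is_derive; exact: mulr1.
by rewrite mulrC; exact: (is_derive1_comp (is_derive_expR _) dl).
Qed.

Lemma C2_exp_coord (R : realType) n (l : R) (i : 'I_n) (U : set 'rV[R]_n) :
  open U -> Ck 2 U (fun q => expR (l * q 0 i) : R^o).
Proof.
move=> oU; have := @C2_comp1 R n (fun x => expR (l * x)) (fun x => l * expR (l * x))
  (fun x => l * (l * expR (l * x))) U (fun q => q 0 i : R^o) oU (Ck_coord 2 U i).
apply => q _.
- exact: is_derive_expRM.
- exact: (@is_deriveZ R R^o R^o _ l _ 1 _ (is_derive_expRM _ _)).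
- apply: (@continuous_at_mul R R (fun=> l) (fun x => l * expR (l * x))).
    exact: cst_continuous.
  apply: (@continuous_at_mul R R (fun=> l) (fun x => expR (l * x))).
    exact: cst_continuous.
  apply: (@continuous_comp _ _ _ ( *%R l : R -> R) expR); last exact: continuous_expR.
  exact: mulrl_continuous.
Qed.

(** * The weak maximum principle *)

Section MaximumPrinciple.
Variables (R : realType) (n : nat) (M : topologicalType).
Variables (S : smooth_manifold R n M) (g : riemannian_metric S).
Implicit Types (a : atlas_idx S) (q : 'rV[R]_n) (U : set 'rV[R]_n).

(** Within the open image of the chart, the image of [Om] is its preimage under the continuous
    inverse chart. *)
Lemma open_chart_image a (Om : set M) : open Om ->
  Om `<=` chart_dom (atlas a) -> open (chart_map (atlas a) @` Om).
Proof.
move=> oOm sub; rewrite openE => _ [p Omp <-]; rewrite /interior.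
have Uq : chart_im (atlas a) (chart_map (atlas a) p) by exists p => //; exact: sub.
have nU : nbhs (chart_map (atlas a) p) (chart_im (atlas a)).
  by apply: open_nbhs_nbhs; split=> //; exact: open_chart_im.
have nOm : nbhs (chart_inv (atlas a) (chart_map (atlas a) p)) Om.
  by rewrite chart_mapK; [apply: open_nbhs_nbhs|exact: sub].
have ninv := @chart_inv_cont _ _ _ (atlas a) _ Uq _ nOm.
apply: filterS2 nU ninv => _ [r dr <-] /=; rewrite chart_mapK // => Or.
by exists r.
Qed.

Lemma inv_metric_continuous a i j q : chart_im (atlas a) q ->
  {for q, continuous (fun x => inv_metric g a x i j)}.
Proof.
move=> Uq; apply: (@continuous_at_invmx _ _ n (metric g a)).
  move=> k l; exact: (@metric_smooth _ _ _ _ g a k l 0%N q Uq).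
apply: filterS (open_nbhs_nbhs (conj (@open_chart_im _ _ _ _ a) Uq)) => x Ux.
exact: metric_unit.
Qed.

Lemma christoffel_continuous a k i j q : chart_im (atlas a) q ->
  {for q, continuous (christoffel g a k i j)}.
Proof.
move=> Uq; rewrite /christoffel.
have cm b c d : {for q, continuous (partial b (metric_coef g a c d))}.
  by case: (@metric_smooth _ _ _ _ g a c d 1%N) => _ /(_ b); exact.
apply: (@continuous_at_mul _ 'rV[R]_n); first exact: cst_continuous.
apply: (@continuous_at_sum _ 'rV[R]_n) => l.
apply: (@continuous_at_mul _ 'rV[R]_n); first exact: inv_metric_continuous.
exact: (cvgB (cvgD (cm i j l) (cm j i l)) (cm l i j)).
Qed.

(** This entry is the value of the metric on row i of its inverse, a nonzero vector. *)
Lemma inv_metric_diag_gt0 a i q : chart_im (atlas a) q -> 0 < inv_metric g a q i i.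
Proof.
move=> Uq; have uG := metric_unit g Uq.
have v0 : row i (inv_metric g a q) != 0.
  apply/eqP => r0; have : row i (1%:M : 'M[R]_n) == 0.
    by rewrite -(mulVmx uG) row_mul -/(inv_metric g a q) r0 mul0mx.
  by apply/negP/eqP => /rowP /(_ i); rewrite !mxE eqxx; apply/eqP; rewrite oner_eq0.
have := metric_pos g Uq v0.
by rewrite -row_mul mulVmx // row1 -rowE !mxE.
Qed.

(** The Laplacian of exp(l q_i) is l exp(l q_i) (l g^ii - b), and b / g^ii is continuous, hence
    bounded above on the compact set [D]. *)
Lemma exp_coord_subsolution a (i : 'I_n) (D : set M) :
  compact D -> D `<=` chart_dom (atlas a) ->
  exists l : R, forall p, D p ->
    0 < laplacian g a (fun x => expR (l * x 0 i)) (chart_map (atlas a) p).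
Proof.
move=> cD sub.
(* [b] is minus the Laplacian of the coordinate q_i. *)
pose b q := \sum_j \sum_k inv_metric g a q j k * christoffel g a i j k q.
pose beta q := (inv_metric g a q i i)^-1 * b q.
have [D0|[p0 Dp0]] : D = set0 \/ D !=set0.
  by have [->|/set0P] := eqVneq D set0; [left|right].
  by exists 0; rewrite D0.
have im p : D p -> chart_im (atlas a) (chart_map (atlas a) p).
  by move=> Dp; exists p => //; exact: sub.
have cbeta q : chart_im (atlas a) q -> {for q, continuous beta}.
  move=> Uq; apply: (@continuous_at_mul _ 'rV[R]_n).
    apply: (@continuous_at_inv _ 'rV[R]_n); last exact: inv_metric_continuous.
    by rewrite gt_eqF // inv_metric_diag_gt0.
  do 2!apply: (@continuous_at_sum _ 'rV[R]_n) => ?.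
  apply: (@continuous_at_mul _ 'rV[R]_n); first exact: inv_metric_continuous.
  exact: christoffel_continuous.
have cD1 : {within D, continuous (beta \o chart_map (atlas a))}.
  apply: continuous_in_subspaceT => p /set_mem Dp.
  apply: continuous_comp; first exact/chart_map_cont/sub.
  by apply: cbeta; exact: im.
have [c _ cmax] := compact_EVT_max (ex_intro _ p0 Dp0) cD cD1.
(* Above the maximum of [beta] on [D], and positive. *)
pose l := `|beta (chart_map (atlas a) c)| + 1.
have l0 : 0 < l by rewrite ltr_wpDl.
exists l => p Dp; set q := chart_map _ p.
have Uq : chart_im (atlas a) q by exact: im.
have dF := is_derive_expRM l.
have dF1 (x : R) : is_derive x 1 (fun x => l * expR (l * x)) (l * (l * expR (l * x))).
  exact: (@is_deriveZ R R^o R^o _ l x 1 _ (dF x)).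
rewrite (@laplacian_comp1 _ _ _ _ g a setT (fun x => x 0 i) (fun x => expR (l * x))
  (fun x => l * expR (l * x)) (fun x => l * (l * expR (l * x)))
  q openT I (@Ck_coord _ _ _ _ _)) //.
have pc j x : partial j (fun x : 'rV[R]_n => x 0 i : R^o) x = (delta_mx 0 j : 'rV[R]_n) 0 i.
  by rewrite (@partial_coord _ _ _ id) // /partial derive_id.
have -> : laplacian g a (fun x => x 0 i) q = - b q.
  rewrite /laplacian /b -sumrN; apply: eq_bigr => j _; rewrite -sumrN.
  apply: eq_bigr => k _; rewrite /hessian.
  rewrite (_ : partial k _ = fun=> (delta_mx 0 k : 'rV[R]_n) 0 i); last first.
    by apply/funext => x; exact: pc.
  rewrite partial_cst sub0r (bigD1 i) //= pc mxE !eqxx mulr1 big1 ?addr0 ?mulrN //.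
  by move=> m mi; rewrite pc mxE eq_sym (negPf mi) mulr0.
have -> : grad_sq g a (fun x => x 0 i) q = inv_metric g a q i i.
  rewrite /grad_sq (bigD1 i) //= (bigD1 i) //= !pc !mxE !eqxx !mulr1.
  rewrite big1 ?addr0; last first.
    by move=> k ki; rewrite !pc !mxE [i == k]eq_sym (negPf ki) !mulr0.
  rewrite big1 ?addr0 // => k ki; rewrite big1 // => m _.
  by rewrite !pc !mxE [i == k]eq_sym (negPf ki) mul0r mulr0.
have gt0 := inv_metric_diag_gt0 i Uq.
have : beta q < l.
  rewrite ltr_pwDr // (le_trans _ (ler_norm _)) //; apply: cmax; exact/mem_set.
rewrite /beta ltr_pdivrMl // => bl.
rewrite (_ : _ + _ = l * expR (l * q 0 i) * (inv_metric g a q i i * l - b q)); last by ring.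
by rewrite !mulr_gt0 ?expR_gt0 // subr_gt0.
Qed.

End MaximumPrinciple.

(** * Subharmonicity of C^2 functions and parabolicity *)

Section Subharmonic.
Variables (R : realType) (n : nat) (M : topologicalType).
Variables (S : smooth_manifold R n M) (g : riemannian_metric S).
Variables (N : nat) (X : M -> 'rV[R]_N).
Hypotheses (n_ge1 : (1 <= n)%N) (Xiso : isometric_immersion g X).
Implicit Types (a : atlas_idx S) (u : M -> R^o).

Lemma chart_smooth_continuous u k :
  (forall a, Ck k (chart_im (atlas a)) (u \o chart_inv (atlas a))) -> continuous u.
Proof.
move=> Cu p; have [a dp] := atlas_cover S p.
have Uq : chart_im (atlas a) (chart_map (atlas a) p) by exists p.
have cu := Ck_continuous (Cu a) Uq.
have np : nbhs p (chart_dom (atlas a)).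
  by apply: open_nbhs_nbhs; split=> //; exact: chart_dom_open.
apply: (@continuous_at_near_eq _ _ ((u \o chart_inv (atlas a)) \o chart_map (atlas a))).
  by apply: filterS np => x dx /=; rewrite chart_mapK.
by apply: continuous_comp; [exact: chart_map_cont|exact: cu].
Qed.

(** The comparison is proved up to [eps]: a perturbation of size at most [eps] makes the Laplacian
    of u - h positive and so excludes an interior maximum. *)
Lemma laplacian_ge0_subharmonic u :
  (forall a, Ck 2 (chart_im (atlas a)) (u \o chart_inv (atlas a))) ->
  (forall a q, chart_im (atlas a) q -> 0 <= laplacian g a (u \o chart_inv (atlas a)) q) ->
  subharmonic g u.
Proof.
move=> Cu Lu a Om h oOm cD sub ch Ch Lh bd p Omp.
have i : 'I_n by case: (n) n_ge1 => // n' _; exact: ord0.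
have [l Lphi] := exp_coord_subsolution g i cD sub.
pose psi (q : 'rV[R]_n) : R^o := expR (l * q 0 i).
have Cpsi : Ck 2 setT psi by apply: C2_exp_coord; exact: openT.
set c := atlas a in cD sub Ch Lh Lphi *.
have oOm' : open (chart_map c @` Om).
  apply: open_chart_image => // x Omx; apply: sub; exact: subset_closure.
have sub' : chart_map c @` Om `<=` chart_im c.
  by move=> _ [x Omx <-]; exists x => //; apply: sub; exact: subset_closure.
have cpsi : {within closure Om, continuous (psi \o chart_map c)}.
  apply: continuous_in_subspaceT => x /set_mem Dx.
  apply: continuous_comp; first exact/chart_map_cont/sub.
  exact: (Ck_continuous Cpsi).
have Dp : closure Om p by exact: subset_closure.
have D0 : closure Om !=set0 by exists p.
have [z _ zmax] := compact_EVT_max D0 cD cpsi.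
pose K : R := psi (chart_map c z).
have K0 : 0 < K by exact: expR_gt0.
apply/ler_addgt0Pr => eps eps0; rewrite -lerBlDl.
(* [K] is the maximum of the exponential barrier on the closure, so d * psi is at most [eps]
   there. *)
pose d := eps / K.
have d0 : 0 < d by rewrite divr_gt0.
pose W (x : M) : R := u x - h x + d * psi (chart_map c x).
have cW : {within closure Om, continuous W}.
  move=> x; apply: cvgD; last first.
    by apply: cvgM; [exact: cvg_cst|exact: cpsi].
  apply: cvgB; last exact: ch.
  by apply: continuous_subspaceT; exact: chart_smooth_continuous Cu.
have [m /set_mem Dm mmax] := compact_EVT_max D0 cD cW.
have Wp : u p - h p <= W p by rewrite lerDl mulr_ge0 ?expR_ge0 // ltW.
apply: le_trans Wp _; apply: le_trans (mmax _ (mem_set Dp)) _.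
(* At a boundary maximum u <= h, and only the perturbation remains. *)
have [Omm|nOmm] := pselect (Om m); last first.
  have um : u m <= h m by exact: bd.
  rewrite /W -[leRHS]add0r lerD ?subr_le0 //.
  by rewrite /d mulrAC ler_pdivrMr // ler_wpM2l ?(ltW eps0) //; apply: zmax; exact/mem_set.
(* An interior maximum would make the Laplacian of [f] nonpositive, but h contributes 0, u a
   nonnegative and psi a positive term. *)
exfalso.
have Uq : (chart_map c @` Om) (chart_map c m) by exists m.
pose f1 : 'rV[R]_n -> R^o := fun x => (u \o chart_inv c) x + (-1) * (h \o chart_inv c) x.
pose f : 'rV[R]_n -> R^o := fun x => f1 x + d * psi x.
have Cu' := Ck_sub sub' (Cu a).
have Cpsi' := Ck_sub (@subsetT _ (chart_map c @` Om)) Cpsi.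
have Cf1 : Ck 2 (chart_map c @` Om) f1.
  exact: (Ck_add oOm' Cu' (Ck_mul oOm' (@Ck_cst _ _ R^o 2 _ (-1)) Ch)).
have Cf : Ck 2 (chart_map c @` Om) f.
  exact: (Ck_add oOm' Cf1 (Ck_mul oOm' (@Ck_cst _ _ R^o 2 _ d) Cpsi')).
have fW x : Om x -> f (chart_map c x) = W x.
  move=> Omx; rewrite /f /f1 /W /= chart_mapK ?mulN1r //.
  by apply: sub; exact: subset_closure.
have := laplacian_at_max (inv_metric_factor Xiso (sub' _ Uq)) oOm' Uq Cf.
rewrite leNgt => /(_ _)/negP; apply.
  move=> _ [x Omx <-]; rewrite !fW //; apply: mmax; apply/mem_set; exact: subset_closure.
rewrite /f (laplacianDZ g a d oOm' Uq Cf1 Cpsi') /f1.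
rewrite (laplacianDZ g a (-1) oOm' Uq Cu' Ch) Lh // mulr0 addr0.
apply: ltr_wpDl; first by apply: Lu; exact: sub'.
by rewrite mulr_gt0 //; exact: Lphi.
Qed.

(** Parabolicity enters the later arguments only in this form. *)
Lemma parabolic_constant u : parabolic g ->
  (forall a, Ck 2 (chart_im (atlas a)) (u \o chart_inv (atlas a))) ->
  (forall a q, chart_im (atlas a) q -> 0 <= laplacian g a (u \o chart_inv (atlas a)) q) ->
  has_ubound (range u) -> exists k : R, forall p, u p = k.
Proof.
move=> par Cu Lu ub; apply: par => //; first exact: chart_smooth_continuous Cu.
exact: laplacian_ge0_subharmonic.
Qed.

End Subharmonic.

(** * Immersed submanifolds and solitons *)

Section Dotp.
Variables (R : realType) (N : nat).
Implicit Types u v w : 'rV[R]_N.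

Lemma dotpC u v : dotp u v = dotp v u.
Proof. by apply: eq_bigr => k _; rewrite mulrC. Qed.

Lemma dotpZl (c : R) u v : dotp (c *: u) v = c * dotp u v.
Proof. by rewrite !dotpE -scalemxAl mxE. Qed.

Lemma dotpZr (c : R) u v : dotp u (c *: v) = c * dotp u v.
Proof. by rewrite dotpC dotpZl dotpC. Qed.

Lemma dotp_sumr (I : finType) u (F : I -> 'rV[R]_N) :
  dotp u (\sum_i F i) = \sum_i dotp u (F i).
Proof.
rewrite dotpE raddf_sum mulmx_sumr summxE.
by apply: eq_bigr => i _; rewrite dotpE.
Qed.

Lemma dotp_ge0 u : 0 <= dotp u u.
Proof. by apply: sumr_ge0 => k _; rewrite -expr2 sqr_ge0. Qed.

Lemma dotp_eq0 u : (dotp u u == 0) = (u == 0).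
Proof.
apply/eqP/eqP => [|->]; last by rewrite /dotp big1 // => k _; rewrite mxE mul0r.
move=> u0; apply/rowP => k; rewrite mxE; apply/eqP; rewrite -sqrf_eq0.
move: u0 => /eqP; rewrite psumr_eq0 => [|l _]; last by rewrite -expr2 sqr_ge0.
by move=> /allP /(_ k); rewrite mem_index_enum expr2 => /(_ isT).
Qed.

Lemma dotp_gt0 u : u != 0 -> 0 < dotp u u.
Proof. by move=> u0; rewrite lt_neqAle eq_sym dotp_eq0 u0 dotp_ge0. Qed.

End Dotp.

Lemma Ck_entry (R : realType) n N k U (f : 'rV[R]_n -> 'rV[R]_N) (l : 'I_N) :
  open U -> Ck k U f -> Ck k U (fun q => f q 0 l : R^o).
Proof.
move=> oU cf; have := Ck_dotp oU cf (@Ck_cst _ _ _ k U (delta_mx 0 l)).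
apply: (Ck_ext oU) => q _ /=.
by rewrite dotpE trmx_delta -colE mxE.
Qed.

Lemma partialC_row (R : realType) n N U (f : 'rV[R]_n -> 'rV[R]_N) q i j :
  open U -> Ck 2 U f -> U q -> partial i (partial j f) q = partial j (partial i f) q.
Proof.
move=> oU cf Uq; have [df dpf] := cf.
have E k l m : partial k (partial l f) q 0 m =
    partial k (partial l (fun x => f x 0 m : R^o)) q.
  have [dl _] := dpf l.
  rewrite -(partial_coord k m (dl q Uq)).
  apply: near_eq_derive; apply: (eq_on_near oU) Uq => x /set_mem Ux.
  by rewrite (partial_coord l m (df x Ux)).
apply/rowP => m.
exact: (etrans (E i j m) (etrans (partialC i j oU (Ck_entry m oU cf) Uq) (esym (E j i m)))).
Qed.

(* P b d and Q b stand for the second and first partial derivatives of an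
   immersion; the brackets are those of the Christoffel symbols. *)
Lemma koszul_formula (R : realType) (I : Type) N (P : I -> I -> 'rV[R]_N)
    (Q : I -> 'rV[R]_N) (c : R) (i j l : I) :
  (forall b d, P b d = P d b) ->
  2^-1 * (c * (dotp (P i j) (Q l) + dotp (Q j) (P i l) +
    (dotp (P j i) (Q l) + dotp (Q i) (P j l)) -
    (dotp (P l i) (Q j) + dotp (Q i) (P l j)))) = c * dotp (P i j) (Q l).
Proof.
move=> PC; rewrite (PC j i) (PC l i) (PC l j) (dotpC (Q j)).
by field.
Qed.

Section ImmersedGeometry.
Variables (R : realType) (n : nat) (M : topologicalType).
Variables (S : smooth_manifold R n M) (g : riemannian_metric S).
Variables (N : nat) (X : M -> 'rV[R]_N).
Hypothesis Xiso : isometric_immersion g X.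
Implicit Types (a : atlas_idx S) (q : 'rV[R]_n).

Local Notation x_ := (param X).

Definition sqnorm (p : M) : R^o := dotp (X p) (X p).

Lemma sqnorm_Ck a k : Ck k (chart_im (atlas a)) (sqnorm \o chart_inv (atlas a)).
Proof.
exact: (Ck_dotp (@open_chart_im _ _ _ S a) (param_Ck Xiso a k) (param_Ck Xiso a k)).
Qed.

Lemma partial_param_diff a i q : chart_im (atlas a) q ->
  differentiable (partial i (x_ a)) q.
Proof. by move=> Uq; case: (param_Ck Xiso a 2) => _ /(_ i) [d _]; exact: d. Qed.

Lemma partial_sqnorm a i q : chart_im (atlas a) q ->
  partial i (sqnorm \o chart_inv (atlas a)) q = 2 * dotp (x_ a q) (partial i (x_ a) q).
Proof.
move=> Uq; have dx := param_diff Xiso Uq.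
by rewrite (partial_dotp i dx dx) dotpC mulr_natl mulr2n.
Qed.

Lemma partial2_sqnorm a i j q : chart_im (atlas a) q ->
  partial i (partial j (sqnorm \o chart_inv (atlas a))) q =
  2 * (metric g a q i j + dotp (x_ a q) (partial i (partial j (x_ a)) q)).
Proof.
move=> Uq; have dx := param_diff Xiso Uq; have dxj := partial_param_diff j Uq.
transitivity (partial i (fun x => 2 * dotp (x_ a x) (partial j (x_ a) x) : R^o) q).
  apply: near_eq_derive; apply: (eq_on_near (@open_chart_im _ _ _ S a)) Uq => y /set_mem Uy.
  exact: partial_sqnorm.
have dc := @differentiable_cst _ ('rV[R]_n) R^o (2 : R) q.
rewrite (partialM i dc (differentiable_dotp dx dxj)) partial_cst mul0r add0r.
by rewrite (partial_dotp i dx dxj) (metric_dotp Xiso).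
Qed.

Lemma partial_metric a i j k q : chart_im (atlas a) q ->
  partial k (metric_coef g a i j) q =
  dotp (partial k (partial i (x_ a)) q) (partial j (x_ a) q) +
  dotp (partial i (x_ a) q) (partial k (partial j (x_ a)) q).
Proof.
move=> Uq; rewrite -(partial_dotp k (partial_param_diff i Uq) (partial_param_diff j Uq)).
apply: near_eq_derive; apply: (eq_on_near (@open_chart_im _ _ _ S a)) Uq => y /set_mem Uy.
exact: metric_dotp.
Qed.

(** Differentiating g_ij = <d_i X, d_j X> and cancelling by symmetry of second partials leaves the
    coefficients of the tangential part of d_i d_j X in the frame of the d_k X. *)
Lemma christoffel_immersed a k i j q : chart_im (atlas a) q ->
  christoffel g a k i j q =
  \sum_l inv_metric g a q k l *
    dotp (partial i (partial j (x_ a)) q) (partial l (x_ a) q).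
Proof.
move=> Uq; rewrite /christoffel mulr_sumr; apply: eq_bigr => l _.
have pC b c := partialC_row b c (@open_chart_im _ _ _ S a) (param_Ck Xiso a 2) Uq.
have pM b c d := partial_metric c d b Uq.
apply: etrans (congr1 _ (congr1 _ (congr2 _ (congr2 _ (pM i j l) (pM j i l))
  (congr1 _ (pM l i j))))) _.
exact: (koszul_formula (fun b => partial b (x_ a) q) _ i j l pC).
Qed.

(** The matrix of [normal_part], acting on row vectors from the right; self-adjointness and
    idempotence of the projection become matrix identities. *)
Definition normal_proj a q : 'M[R]_N :=
  1%:M - ('J (x_ a) q)^T *m inv_metric g a q *m 'J (x_ a) q.

Lemma normal_partE a q v : chart_im (atlas a) q ->
  normal_part X a q v = v *m normal_proj a q.
Proof.
move=> Uq; rewrite /normal_part /normal_proj /inv_metric -(metric_jac Xiso Uq).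
by rewrite mulmxBr mulmx1 !mulmxA.
Qed.

Lemma normal_proj_sym a q : chart_im (atlas a) q ->
  (normal_proj a q)^T = normal_proj a q.
Proof.
move=> Uq; rewrite /normal_proj linearB /= trmx1 !trmx_mul trmxK mulmxA.
by rewrite /inv_metric trmx_inv metric_sym.
Qed.

Lemma normal_proj_idem a q : chart_im (atlas a) q ->
  normal_proj a q *m normal_proj a q = normal_proj a q.
Proof.
move=> Uq; rewrite {1}/normal_proj mulmxBl mul1mx /normal_proj.
rewrite [X in _ - X](_ : _ = 0) ?subr0 // mulmxBr mulmx1 !mulmxA.
rewrite -[X in _ - X *m _ *m _]mulmxA -(metric_jac Xiso Uq).
by rewrite -[X in _ - X *m _]mulmxA /inv_metric mulmxV ?metric_unit // mulmx1 subrr.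
Qed.

Lemma dotp_normal_proj a q u v : chart_im (atlas a) q ->
  dotp u (v *m normal_proj a q) = dotp (u *m normal_proj a q) v.
Proof.
by move=> Uq; rewrite !dotpE trmx_mul normal_proj_sym // mulmxA.
Qed.

(** The inner sum is the coefficient of d_k X in the tangential part of v. For v = d_i d_j X it is a
    Christoffel symbol, whence this form. *)
Lemma dotp_normal a q u v : chart_im (atlas a) q ->
  dotp u (v *m normal_proj a q) = dotp u v -
  \sum_k (\sum_l inv_metric g a q k l * dotp v (partial l (x_ a) q)) *
    dotp u (partial k (x_ a) q).
Proof.
move=> Uq; have Jt w k : (w *m ('J (x_ a) q)^T) 0 k = dotp w (partial k (x_ a) q).
  by rewrite (partial_row Xiso) // mxE; apply: eq_bigr => m _; rewrite !mxE.
rewrite dotpE /normal_proj mulmxBr mulmx1 linearB /= mulmxBr mxE -dotpE.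
rewrite mxE; congr (_ - _); rewrite !trmx_mul -!mulmxA [u *m _]mulmxA mxE.
apply: eq_bigr => k _; rewrite Jt mulrC; congr (_ * _).
rewrite mxE; apply: eq_bigr => l _; rewrite /inv_metric trmx_inv metric_sym //.
congr (_ * _); rewrite -Jt mxE [RHS]mxE; apply: eq_bigr => m _.
by rewrite !mxE mulrC.
Qed.

End ImmersedGeometry.

(** * The function |X|^2 on a soliton *)

Section Soliton.
Variables (R : realType) (n : nat) (M : topologicalType).
Variables (S : smooth_manifold R n M) (g : riemannian_metric S).
Variables (N : nat) (X : M -> 'rV[R]_N).
Hypothesis Xiso : isometric_immersion g X.
Implicit Types (a : atlas_idx S) (q : 'rV[R]_n).

Local Notation x_ := (param X).
Local Notation s_ a := (sqnorm X \o chart_inv (atlas a)).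
Local Notation P_ := (normal_proj g X).

Lemma mean_curvatureE a q : chart_im (atlas a) q ->
  mean_curvature g X a q =
  (\sum_i \sum_j inv_metric g a q i j *: partial i (partial j (x_ a)) q) *m P_ a q.
Proof.
move=> Uq; rewrite /mean_curvature mulmx_suml; apply: eq_bigr => i _.
rewrite mulmx_suml; apply: eq_bigr => j _.
by rewrite -scalemxAl -(normal_partE Xiso).
Qed.

Lemma inv_metric_trace a q : chart_im (atlas a) q ->
  \sum_i \sum_j inv_metric g a q i j * metric g a q i j = n%:R.
Proof.
move=> Uq; rewrite -(@mxtrace1 R n) -(mulVmx (metric_unit g Uq)).
apply: eq_bigr => i _; rewrite [RHS]mxE; apply: eq_bigr => j _.
by rewrite -[in LHS](metric_sym g Uq) [in LHS]mxE.
Qed.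

(** The Christoffel terms of the Hessian remove exactly the tangential part of d_i d_j X, leaving
    the second fundamental form paired with X. *)
Lemma hessian_sqnorm a i j q : chart_im (atlas a) q ->
  hessian g a (s_ a) i j q =
  2 * (metric g a q i j + dotp (x_ a q) (partial i (partial j (x_ a)) q *m P_ a q)).
Proof.
move=> Uq; rewrite /hessian (partial2_sqnorm Xiso i j Uq) (dotp_normal Xiso _ _ Uq).
under eq_bigr => k _ do
  rewrite (christoffel_immersed Xiso k i j Uq) (partial_sqnorm Xiso k Uq) mulrCA.
by rewrite -mulr_sumr; ring.
Qed.

Lemma laplacian_sqnorm a q : chart_im (atlas a) q ->
  laplacian g a (s_ a) q = 2 * (n%:R + dotp (x_ a q) (mean_curvature g X a q)).
Proof.
move=> Uq; rewrite /laplacian /mean_curvature dotp_sumr -(inv_metric_trace Uq).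
rewrite -big_split mulr_sumr; apply: eq_bigr => i _.
rewrite dotp_sumr -big_split mulr_sumr; apply: eq_bigr => j _ /=.
by rewrite dotpZr -mulrDr mulrCA hessian_sqnorm // -(normal_partE Xiso).
Qed.

(** The gradient of |X|^2 is 2 X^T, and the bracket is |X|^2 - |X^perp|^2 = |X^T|^2. *)
Lemma grad_sq_sqnorm a q : chart_im (atlas a) q ->
  grad_sq g a (s_ a) q = 4 * (dotp (x_ a q) (x_ a q) - dotp (x_ a q) (x_ a q *m P_ a q)).
Proof.
move=> Uq; rewrite (dotp_normal Xiso _ _ Uq) opprB addrC subrK mulr_sumr.
apply: eq_bigr => i _; rewrite mulr_suml mulr_sumr; apply: eq_bigr => j _.
have alg (c u v : R) : c * (2 * u * (2 * v)) = 4 * (c * v * u) by ring.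
exact: etrans (congr1 (fun z => _ * z) (congr2 *%R (partial_sqnorm Xiso i Uq)
  (partial_sqnorm Xiso j Uq))) (alg _ _ _).
Qed.

Lemma dotp_normal_self a q (v : 'rV[R]_N) : chart_im (atlas a) q ->
  dotp v (v *m P_ a q) = dotp (v *m P_ a q) (v *m P_ a q).
Proof.
by move=> Uq; rewrite (dotp_normal_proj g X (v *m _) v Uq) -mulmxA
  (normal_proj_idem Xiso Uq) dotpC.
Qed.

Lemma grad_sq_sqnorm_le a q : chart_im (atlas a) q ->
  grad_sq g a (s_ a) q <= 4 * dotp (x_ a q) (x_ a q).
Proof.
move=> Uq; rewrite grad_sq_sqnorm // ler_wpM2l // lerBlDr lerDl.
by rewrite dotp_normal_self // dotp_ge0.
Qed.

Variable C : R.
Hypothesis Xsol : imcf_soliton g X C.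

Lemma soliton_mean_curvature a q : chart_im (atlas a) q ->
  let H := mean_curvature g X a q in
  0 < dotp H H /\ H = - (C * dotp H H) *: (x_ a q *m P_ a q).
Proof.
move=> Uq H; have [H0 HE] := Xsol Uq; have hh := dotp_gt0 H0.
split=> //; rewrite -[LHS](scalerK (a := (dotp H H)^-1)) ?invr_eq0 ?gt_eqF //.
by rewrite invrK HE (normal_partE Xiso) // scalerA mulrN mulrC.
Qed.

(** Since H is normal, pairing H = -C |H|^2 X^perp with H gives |H|^2 = -C |H|^2 <X, H>, and |H|^2
    can be cancelled. *)
Lemma soliton_dotp a q : chart_im (atlas a) q ->
  C * dotp (x_ a q) (mean_curvature g X a q) = - 1.
Proof.
move=> Uq; have [h0 HE] := soliton_mean_curvature Uq.
set H := mean_curvature g X a q in h0 HE *.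
have HP : H *m P_ a q = H.
  by rewrite /H mean_curvatureE // -mulmxA (normal_proj_idem Xiso Uq).
have : dotp H H = - (C * dotp H H) * dotp (x_ a q) H.
  rewrite {1}HE dotpZl; congr (_ * _).
  by rewrite -[in RHS]HP (dotp_normal_proj g X _ _ Uq).
move=> E; apply: (mulfI (lt0r_neq0 h0)); rewrite mulrN1 [X in - X]E; ring.
Qed.

Lemma soliton_C_neq0 : C != 0.
Proof.
have [p _] := manifold_nonempty S; have [a dp] := atlas_cover S p.
have Uq : chart_im (atlas a) (chart_map (atlas a) p) by exists p.
by apply/eqP => C0; have := soliton_dotp Uq; rewrite C0 mul0r => /eqP; lra.
Qed.

Lemma soliton_laplacian a q : chart_im (atlas a) q ->
  laplacian g a (s_ a) q = 2 * (n%:R - C^-1).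
Proof.
move=> Uq; rewrite laplacian_sqnorm //; congr (_ * (_ + _)).
by apply: (mulfI soliton_C_neq0); rewrite soliton_dotp // mulrN mulfV ?soliton_C_neq0.
Qed.

Lemma soliton_sqnorm_gt0 (p : M) : 0 < sqnorm X p.
Proof.
have [a dp] := atlas_cover S p.
have Uq : chart_im (atlas a) (chart_map (atlas a) p) by exists p.
rewrite dotp_gt0 //; apply/eqP => x0.
have := soliton_dotp Uq; rewrite /param /= chart_mapK // x0.
by rewrite dotpE mul0mx mxE mulr0 => /eqP; rewrite eq_sym oppr_eq0 oner_eq0.
Qed.

(** As |X|^2 is constant, X is normal to the immersion and the mean curvature in the sphere is H +
    (n / s) X. The soliton equation makes H a multiple of X, and <X, H> = -1/C = -n fixes that
    multiple as -n / s. *)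
Lemma soliton_sphere_minimal (s : R) : C = n%:R^-1 ->
  (forall p, sqnorm X p = s) -> minimal_in_sphere g X (Num.sqrt s).
Proof.
move=> CE sE; have [p0 _] := manifold_nonempty S.
have s0 : 0 < s by rewrite -(sE p0) soliton_sqnorm_gt0.
split=> [p|a q Uq].
  by rewrite /euclid_sphere /= sqr_sqrtr ?ltW // -(sE p).
have xx : dotp (x_ a q) (x_ a q) = s by exact: sE.
have sc : s_ a = (fun=> s) by apply/funext => y; exact: sE.
(* Differentiating <X, X> = s once and twice gives <X, d_k X> = 0 and <d_i d_j X, X> = -g_ij. *)
have d1 k : dotp (x_ a q) (partial k (x_ a) q) = 0.
  have := partial_sqnorm Xiso k Uq; rewrite sc partial_cst => /esym/eqP.
  by rewrite mulf_eq0 pnatr_eq0 => /eqP.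
have d2 i j : dotp (partial i (partial j (x_ a)) q) (x_ a q) = - metric g a q i j.
  have := partial2_sqnorm Xiso i j Uq; rewrite sc.
  rewrite (_ : partial j _ = fun=> 0); last by apply/funext => y; exact: partial_cst.
  rewrite partial_cst => /esym/eqP; rewrite mulf_eq0 pnatr_eq0 /= addrC addr_eq0 => /eqP.
  by rewrite dotpC.
have xP : dotp (x_ a q) (x_ a q *m P_ a q) = s.
  rewrite (dotp_normal Xiso _ _ Uq) xx big1 ?subr0 // => k _.
  by rewrite (d1 k) mulr0.
(* Removing the radial part of d_i d_j X adds (g_ij / s) X, and the trace of g_ij is n. *)
have -> : sphere_mean_curvature g X a q =
    mean_curvature g X a q + (n%:R / s) *: (x_ a q *m P_ a q).
  rewrite /sphere_mean_curvature /mean_curvature -(inv_metric_trace Uq).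
  rewrite mulr_suml scaler_suml -big_split; apply: eq_bigr => i _ /=.
  rewrite mulr_suml scaler_suml -big_split; apply: eq_bigr => j _ /=.
  rewrite /sphere_second_fund_form /second_fund_form !(normal_partE Xiso) //.
  rewrite /sphere_tangent_part xx d2 mulmxBl scalerBr; congr (_ + _).
  by rewrite -scalemxAl scalerA mulNr mulrN scaleNr opprK mulrA.
have [h0 HE] := soliton_mean_curvature Uq.
have := soliton_dotp Uq; move: h0 HE; set H := mean_curvature g X a q => h0 HE.
(* [E] amounts to C^2 |H|^2 s = 1; with n = 1/C this says that the coefficient n / s - C |H|^2
   vanishes. *)
rewrite {1}HE dotpZr xP => E; rewrite HE -scalerDl.
rewrite (_ : _ + _ = 0) ?scale0r //.
have C0 := soliton_C_neq0; have nE : n%:R = C^-1 by rewrite CE invrK.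
rewrite nE; apply: (mulfI C0); apply: (mulIf (lt0r_neq0 s0)).
rewrite mulr0 mul0r -mulrA mulrDl mulrDr divfK ?gt_eqF // mulfV //.
by rewrite E addNr.
Qed.

End Soliton.

(** * Independence of |grad u|^2 from the chart *)

Section GradientNorm.
Variables (R : realType) (n : nat) (M : topologicalType).
Variables (S : smooth_manifold R n M) (g : riemannian_metric S).
Implicit Types (a b : atlas_idx S) (q : 'rV[R]_n) (f : 'rV[R]_n -> R^o).

Lemma grad_sqE a f q : let D := \col_i partial i f q in
  grad_sq g a f q = (D^T *m inv_metric g a q *m D) 0 0.
Proof.
rewrite /grad_sq exchange_big mxE; apply: eq_bigr => i _.
rewrite !mxE mulr_suml; apply: eq_bigr => j _.
by rewrite !mxE mulrCA mulrA.
Qed.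

Lemma laplacian_locally_cst a U f q : open U -> U q ->
  (forall i x, U x -> partial i f x = 0) -> laplacian g a f q = 0.
Proof.
move=> oU Uq df; rewrite /laplacian big1 // => i _; rewrite big1 // => j _.
have -> : hessian g a f i j q = 0; last by rewrite mulr0.
rewrite /hessian big1 ?subr0 => [|k _]; last by rewrite (df k q Uq) mulr0.
rewrite -[RHS](@partial_cst _ _ R^o 0 i q).
apply: near_eq_derive; apply: (eq_on_near oU) Uq => x /set_mem Ux.
exact: df.
Qed.

Lemma partial_transition (u : M -> R^o) a b p i :
  chart_dom (atlas a) p -> chart_dom (atlas b) p ->
  differentiable (u \o chart_inv (atlas b)) (chart_map (atlas b) p) ->
  let q := chart_map (atlas a) p in
  partial i (u \o chart_inv (atlas a)) q =
  \sum_k 'J (transition (atlas a) (atlas b)) q i k *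
    partial k (u \o chart_inv (atlas b)) (chart_map (atlas b) p).
Proof.
move=> da db du q.
set D := chart_dom (atlas a) `&` chart_dom (atlas b).
set t := transition _ _.
have tq : t q = chart_map (atlas b) p by rewrite /t /transition /= chart_mapK.
have oD : open (chart_map (atlas a) @` D).
  apply: open_chart_image; last by move=> x [].
  by apply: openI; exact: chart_dom_open.
have Dq : (chart_map (atlas a) @` D) q by exists p.
have dt : differentiable t q by case: (@atlas_smooth _ _ _ S a b 1%N) => + _; exact.
have du' : differentiable (u \o chart_inv (atlas b)) (t q) by rewrite tq.
transitivity (partial i ((u \o chart_inv (atlas b)) \o t : _ -> R^o) q).
  apply: near_eq_derive; apply: (eq_on_near oD) Dq => _ /set_mem[r [ra rb] <-].
  by rewrite /t /transition /= !chart_mapK.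
rewrite /partial deriveE; last exact: differentiable_comp.
rewrite diff_comp //= -(deriveE _ du') derive_sum_partial // tq.
apply: eq_bigr => k _; rewrite -(deriveE _ dt) deriveEjacobian //.
by rewrite -rowE mxE.
Qed.

(** Partial derivatives change by J and the metric by G_a = J G_b J^T, so J^T G_a^-1 J = G_b^-1.
    This lets a function on [M] be built from |grad u|^2 with an arbitrary chart at each point. *)
Lemma grad_sq_chart (u : M -> R^o) a b p :
  (forall c : atlas_idx S, Ck 1 (chart_im (atlas c)) (u \o chart_inv (atlas c))) ->
  chart_dom (atlas a) p -> chart_dom (atlas b) p ->
  grad_sq g a (u \o chart_inv (atlas a)) (chart_map (atlas a) p) =
  grad_sq g b (u \o chart_inv (atlas b)) (chart_map (atlas b) p).
Proof.
move=> Cu da db; rewrite !grad_sqE.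
have Ua : chart_im (atlas a) (chart_map (atlas a) p) by exists p.
have Ub : chart_im (atlas b) (chart_map (atlas b) p) by exists p.
have du : differentiable (u \o chart_inv (atlas b)) (chart_map (atlas b) p).
  by case: (Cu b) => + _; exact.
have ch i := partial_transition i da db du.
have uG := metric_unit g Ua; have := metric_change g da db.
set J := 'J _ _ => GE.
have -> : \col_i partial i (u \o chart_inv (atlas a)) (chart_map (atlas a) p) =
    J *m \col_i partial i (u \o chart_inv (atlas b)) (chart_map (atlas b) p).
  apply/colP => i; rewrite !mxE; apply: etrans (ch i) _.
  by apply: eq_bigr => k _; congr (_ * _); rewrite mxE.
move: (\col_i _) => D.
have uJ : J^T \in unitmx by move: uG; rewrite GE unitmx_mul => /andP[].
(* Multiplying on the right by J^T, invertible as a factor of G_a, reduces the identity to G_a^-1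
   G_a = 1. *)
have KG : J^T *m inv_metric g a (chart_map (atlas a) p) *m J *m
    metric g b (chart_map (atlas b) p) = 1%:M.
  apply: (can_inj (mulmxK uJ)); rewrite mul1mx -!mulmxA (mulmxA J) -GE.
  by rewrite /inv_metric mulVmx // mulmx1.
rewrite [in RHS]/inv_metric.
have -> : invmx (metric g b (chart_map (atlas b) p)) =
    J^T *m inv_metric g a (chart_map (atlas a) p) *m J.
  by rewrite -[LHS]mul1mx -KG mulmxK // metric_unit.
by rewrite trmx_mul !mulmxA.
Qed.

End GradientNorm.

Lemma is_derive_powR (R : realType) (b x : R) : 0 < x ->
  is_derive x 1 (fun y => y `^ b) (b * x `^ (b - 1)).
Proof.
move=> x0; have xI : x \in `]0, +oo[ by rewrite in_itv /= x0.
split; first exact: derivable_powR.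
by rewrite -derive1E powR_derive1.
Qed.

Lemma is_derive_scale_powR (R : realType) (c b x : R) : 0 < x ->
  is_derive x 1 (fun y => c * y `^ b) (c * b * x `^ (b - 1)).
Proof.
move=> x0; rewrite -mulrA.
exact: (@is_deriveZ R R^o R^o _ c x 1 _ (is_derive_powR b x0)).
Qed.

(** * Consequences of parabolicity for the constant C *)

Section Solitons.
Variables (R : realType) (n : nat) (M : topologicalType).
Variables (S : smooth_manifold R n M) (g : riemannian_metric S).
Variables (N : nat) (X : M -> 'rV[R]_N) (C : R).
Hypotheses (n_ge1 : (1 <= n)%N) (Xiso : isometric_immersion g X).
Hypotheses (Xsol : imcf_soliton g X C) (par : parabolic g).
Implicit Types (a : atlas_idx S) (q : 'rV[R]_n).

Local Notation s_ a := (sqnorm X \o chart_inv (atlas a)).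

Lemma sqnorm_constant_C (s : R) : (forall p, sqnorm X p = s) -> C^-1 = n%:R.
Proof.
move=> sE; have [p _] := manifold_nonempty S; have [a dp] := atlas_cover S p.
have Uq : chart_im (atlas a) (chart_map (atlas a) p) by exists p.
have := soliton_laplacian Xiso Xsol Uq.
rewrite (_ : s_ a = fun=> s) ?laplacian_cst; last by apply/funext => y; exact: sE.
by move=> /esym/eqP; rewrite mulf_eq0 pnatr_eq0 subr_eq0 => /eqP.
Qed.

Lemma soliton_sqnorm_constant : n%:R <= C^-1 -> exists s, forall p, sqnorm X p = s.
Proof.
move=> T0.
(* -s is written as 0 + -1 * s to fit the shape of [laplacianDZ]. *)
have C2s a : Ck 2 (chart_im (atlas a)) (fun q => 0 + -1 * s_ a q : R^o).
  have oU := @open_chart_im _ _ _ S a.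
  have Ck_c c := @Ck_cst _ _ R^o 2 (chart_im (atlas a)) c.
  exact: (Ck_add oU (Ck_c 0) (Ck_mul oU (Ck_c (-1)) (sqnorm_Ck Xiso a 2))).
have [||k kE] := @parabolic_constant R n M S g N X n_ge1 Xiso
    (fun p => 0 + -1 * sqnorm X p) par C2s.
- move=> a q Uq; have oU := @open_chart_im _ _ _ S a.
  rewrite [leRHS](laplacianDZ g a (-1) oU Uq (@Ck_cst _ _ R^o 2 _ 0) (sqnorm_Ck Xiso a 2)).
  rewrite laplacian_cst (soliton_laplacian Xiso Xsol Uq); lra.
- exists 0 => _ [p _ <-]; rewrite add0r mulN1r oppr_le0.
  exact/ltW/(soliton_sqnorm_gt0 Xiso Xsol).
- by exists (- k) => p; rewrite -(kE p) add0r mulN1r opprK.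
Qed.

Lemma soliton_C_bound : n%:R <= C^-1 + 2.
Proof.
rewrite leNgt; apply/negP => T2.
(* With al + 1 = T / 2, the Laplacian of -s^(-al) factors as al (al + 1) s^(-al - 2) (4s - |grad
   s|^2), whose last factor is nonnegative. *)
pose al : R := (n%:R - C^-1) / 2 - 1.
have al0 : 0 < al by rewrite /al; lra.
have TE : n%:R - C^-1 = 2 * (al + 1) by rewrite /al; lra.
move: al al0 TE => al al0 TE.
pose F (x : R) := -1 * x `^ (- al).
pose F1 (x : R) := -1 * - al * x `^ (- al - 1).
pose F2 (x : R) := -1 * - al * (- al - 1) * x `^ (- al - 1 - 1).
have sp := soliton_sqnorm_gt0 Xiso Xsol.
have dF (x : R) : 0 < x -> is_derive x 1 F (F1 x) by exact: is_derive_scale_powR.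
have dF1 (x : R) : 0 < x -> is_derive x 1 F1 (F2 x) by exact: is_derive_scale_powR.
have cF2 (x : R) : 0 < x -> {for x, continuous F2}.
  move=> x0; apply: differentiable_continuous; apply/derivable1_diffP.
  by have [] := is_derive_scale_powR (-1 * - al * (- al - 1)) (- al - 1 - 1) x0.
have C2F a : Ck 2 (chart_im (atlas a)) (fun q => F (s_ a q) : R^o).
  have := @C2_comp1 R n F F1 F2 _ (s_ a) (@open_chart_im _ _ _ S a) (sqnorm_Ck Xiso a 2).
  apply=> q _; [exact/dF/sp|exact/dF1/sp|exact/cF2/sp].
have [||k kE] := @parabolic_constant R n M S g N X n_ge1 Xiso
    (fun p => F (sqnorm X p)) par C2F.
- move=> a q Uq; have oU := @open_chart_im _ _ _ S a.
  have s0 : 0 < s_ a q by exact: sp.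
  rewrite [leRHS](@laplacian_comp1 _ _ _ _ g a _ (s_ a) F F1 F2 q oU Uq (sqnorm_Ck Xiso a 2)
    (fun x _ => dF _ (sp _)) (dF1 _ s0)).
  rewrite (soliton_laplacian Xiso Xsol Uq).
  have gs : grad_sq g a (s_ a) q <= 4 * s_ a q := grad_sq_sqnorm_le Xiso Uq.
  (* The power s^(-al - 1) is split so that both terms of the Laplacian share the factor s^(-al -
     2). *)
  have F1E : F1 (s_ a q) = al * (s_ a q * s_ a q `^ (- al - 1 - 1)).
    rewrite /F1 mulN1r opprK; congr (_ * _).
    rewrite -{2}(powRr1 (ltW s0)) -powRD; first by congr (_ `^ _); ring.
    by rewrite (gt_eqF s0) implybT.
  rewrite F1E /F2; move: gs s0 (powR_gt0 (- al - 1 - 1) s0).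
  move: (s_ a q) (grad_sq _ _ _ _) (_ `^ _) => s G Q gs s0 Q0.
  have -> : al * (s * Q) * (2 * (n%:R - C^-1)) + -1 * - al * (- al - 1) * Q * G =
      al * (al + 1) * Q * (4 * s - G) by rewrite TE; ring.
  by rewrite mulr_ge0 ?subr_ge0 // mulr_ge0 ?(ltW Q0) // mulr_ge0 // ?addr_ge0 // ltW.
- exists 0 => _ [p _ <-]; rewrite /F mulN1r oppr_le0; exact: powR_ge0.
- have TC : C^-1 = n%:R; last by move: T2; rewrite TC; lra.
  (* The constant value of s is recovered from k = -s^(-al). *)
  apply: (@sqnorm_constant_C ((- k) `^ (- al)^-1)) => p.
  rewrite -(kE p) /F mulN1r opprK -powRrM mulfV ?powRr1 //.
    exact/ltW/sp.
  by rewrite oppr_eq0 gt_eqF.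
Qed.

End Solitons.

(** * Soliton curves *)

Section SolitonCurves.
Variables (R : realType) (M : topologicalType).
Variables (S : smooth_manifold R 1 M) (g : riemannian_metric S).
Variables (N : nat) (X : M -> 'rV[R]_N) (C : R).
Hypotheses (Xiso : isometric_immersion g X).
Hypotheses (Xsol : imcf_soliton g X C) (par : parabolic g).
Implicit Types (a : atlas_idx S) (q : 'rV[R]_1).

Local Notation s_ a := (sqnorm X \o chart_inv (atlas a)).
Local Notation T := (1 - C^-1).

Lemma inv_metric1 a q : chart_im (atlas a) q ->
  inv_metric g a q 0 0 = (metric_coef g a 0 0 q)^-1.
Proof.
move=> Uq; have uG := metric_unit g Uq.
have := congr1 (fun A : 'M[R]_1 => A 0 0) (mulmxV uG).
by rewrite mxE big_ord1 mxE eqxx => /mulr1_eq <-.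
Qed.

(* The first integral |grad s|^2 - 4Ts, computed in an arbitrary chart at p. *)
Definition energy (p : M) : R^o :=
  let a := sval (cid (atlas_cover S p)) in
  grad_sq g a (s_ a) (chart_map (atlas a) p) + - (4 * T) * sqnorm X p.

Lemma energy_chart a q : chart_im (atlas a) q ->
  energy (chart_inv (atlas a) q) = grad_sq g a (s_ a) q + - (4 * T) * s_ a q.
Proof.
move=> [p dp <-]; rewrite /= chart_mapK // /energy; case: cid => b db /=.
by rewrite (grad_sq_chart g (sqnorm_Ck Xiso ^~ 1%N) dp db).
Qed.

(** In dimension one Delta s = (s'' - G' s' / (2G)) / G, so the derivative of s'^2 / G - 4Ts is 2 s'
    (Delta s - 2T), which vanishes because Delta s = 2T on a soliton. *)
Lemma energy_smooth_partial a q : chart_im (atlas a) q ->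
  let f := fun y => (metric_coef g a 0 0 y)^-1 *
    (partial 0 (s_ a) y * partial 0 (s_ a) y) + - (4 * T) * s_ a y : R^o in
  differentiable f q /\ partial 0 f q = 0.
Proof.
move=> Uq f; have [ds d2s] := sqnorm_Ck Xiso a 2.
have {}ds := ds q Uq; have {d2s} [dds _] := d2s 0; have {}dds := dds q Uq.
have dG : differentiable (metric_coef g a 0 0) q.
  by case: (@metric_smooth _ _ _ _ g a 0 0 1%N) => + _; exact.
have G0 : metric_coef g a 0 0 q != 0.
  by rewrite -invr_eq0 -(inv_metric1 Uq) gt_eqF // inv_metric_diag_gt0.
have dV : is_derive (metric_coef g a 0 0 q) 1 (fun y : R => y^-1)
    (- (metric_coef g a 0 0 q) ^- 2).
  have := @is_deriveV R id (metric_coef g a 0 0 q) 1 1 G0 (is_derive_id _ _).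
  by congr is_derive; exact: mulr1.
have dGV := differentiable_comp1 dV dG.
have dss := differentiableM dds dds.
have dc := @differentiable_cst _ 'rV[R]_1 R^o (- (4 * T)) q.
have d1 := differentiableM dGV dss.
have d2 := differentiableM dc ds.
split; first exact: (differentiableD d1 d2).
have E : partial 0 f q = - (metric_coef g a 0 0 q) ^- 2 * partial 0 (metric_coef g a 0 0) q *
      (partial 0 (s_ a) q * partial 0 (s_ a) q) +
    (metric_coef g a 0 0 q)^-1 *
      (partial 0 (partial 0 (s_ a)) q * partial 0 (s_ a) q +
       partial 0 (s_ a) q * partial 0 (partial 0 (s_ a)) q) +
    - (4 * T) * partial 0 (s_ a) q.
  rewrite /f (partialD 0 d1 d2); congr (_ + _).
    rewrite (partialM 0 dGV dss) (partial_comp1 0 dV dG); congr (_ + _ * _).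
    exact: partialM.
  by rewrite (partialM 0 dc ds) partial_cst mul0r add0r.
have := soliton_laplacian Xiso Xsol Uq.
rewrite /laplacian !big_ord1 /hessian big_ord1 /christoffel big_ord1 (inv_metric1 Uq).
rewrite E; move: G0 {E f dV dGV d1}.
move: (metric_coef g a 0 0 q) (partial 0 (metric_coef g a 0 0) q).
move: (partial 0 (partial 0 (s_ a)) q) (partial 0 (s_ a) q) => s2 s1 G dG' G0 LE.
rewrite -[1%:R]/(1 : R) in LE *; move: (1 - C^-1) LE => TT LE.
transitivity (2 * s1 * (G^-1 * (s2 - 2^-1 * (G^-1 * (dG' + dG' - dG')) * s1) - 2 * TT)).
  by field.
by rewrite LE subrr mulr0.
Qed.

(** Since the first partials vanish identically on the chart image, C^2 regularity reduces to
    differentiability. *)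
Lemma energy_C2 a : Ck 2 (chart_im (atlas a)) (energy \o chart_inv (atlas a)) /\
  forall i q, chart_im (atlas a) q -> partial i (energy \o chart_inv (atlas a)) q = 0.
Proof.
pose f := fun y => (metric_coef g a 0 0 y)^-1 *
    (partial 0 (s_ a) y * partial 0 (s_ a) y) + - (4 * T) * s_ a y : R^o.
have oU := @open_chart_im _ _ _ S a.
have fE y : chart_im (atlas a) y -> f y = (energy \o chart_inv (atlas a)) y.
  by move=> Uy; rewrite /= energy_chart // /grad_sq !big_ord1 inv_metric1.
have dfn y : chart_im (atlas a) y -> \near y, f y = (energy \o chart_inv (atlas a)) y.
  by move=> Uy; apply: (eq_on_near oU _ Uy) => z /set_mem; exact: fE.
have d0 i q : chart_im (atlas a) q -> partial i (energy \o chart_inv (atlas a)) q = 0.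
  move=> Uq; rewrite (ord1 i) -(proj2 (energy_smooth_partial Uq)).
  by apply/esym; apply: near_eq_derive; exact: dfn.
split=> //; split=> [q Uq|i].
  exact: (differentiable_near (dfn q Uq) (proj1 (energy_smooth_partial Uq))).
apply: (Ck_ext oU _ (@Ck_cst _ _ R^o 1 _ 0)) => q /set_mem Uq.
by rewrite d0.
Qed.

Lemma soliton_curve_C_gt0 : 0 < C.
Proof.
have C0 := soliton_C_neq0 Xiso Xsol.
rewrite lt_neqAle eq_sym C0 leNgt /=; apply/negP => Cneg.
have T1 : 0 < T - 1 by rewrite addrAC subrr sub0r oppr_gt0 invr_lt0.
have eb p : energy p <= 4 * sqnorm X p + - (4 * T) * sqnorm X p.
  rewrite /energy; case: cid => b db /=; rewrite lerD2r.
  have Ub : chart_im (atlas b) (chart_map (atlas b) p) by exists p.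
  by have := grad_sq_sqnorm_le Xiso Ub; rewrite /param /= chart_mapK.
have sp := soliton_sqnorm_gt0 Xiso Xsol.
have eneg p : 4 * sqnorm X p + - (4 * T) * sqnorm X p = - (4 * ((T - 1) * sqnorm X p)) by ring.
(* The energy has zero Laplacian and is bounded above by -4 (T - 1) s <= 0, hence it is a constant
   k. *)
have [||k kE] := @parabolic_constant R 1 M S g N X isT Xiso energy par
  (fun a => (energy_C2 a).1).
- move=> a q Uq; rewrite (laplacian_locally_cst g a (@open_chart_im _ _ _ S a) Uq) //.
  exact: (energy_C2 a).2.
- exists 0 => _ [p _ <-]; apply: le_trans (eb p) _; rewrite eneg oppr_le0.
  by rewrite mulr_ge0 // mulr_ge0 // ltW.
have [||s sE] := @parabolic_constant R 1 M S g N X isT Xiso (sqnorm X) par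
  (fun a => sqnorm_Ck Xiso a 2).
- move=> a q Uq; rewrite (soliton_laplacian Xiso Xsol Uq); lra.
(* The inequality k <= -4 (T - 1) s, solved for s. *)
- exists (- k / (4 * (T - 1))) => _ [p _ <-]; rewrite ler_pdivlMr ?mulr_gt0 //.
  have := eb p; rewrite kE eneg; lra.
(* A constant s would force 1/C = 1, against C < 0. *)
- by have := sqnorm_constant_C Xiso Xsol sE; lra.
Qed.

End SolitonCurves.

(** * The bounds on C and the equality case *)

Theorem theorem4p1 (R : realType) (n m : nat) (n_ge1 : (1 <= n)%N)
    (M : topologicalType) (S : smooth_manifold R n M)
    (g : riemannian_metric S) (X : M -> 'rV[R]_(n + m)) (C : R)
    (X_isometric : isometric_immersion g X) (M_complete : complete_metric g)
    (X_soliton : imcf_soliton g X C) (M_parabolic : parabolic g) :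
  [/\ self_expander g X C,
      1 / n%:R <= C,
      (2 < n)%N -> C <= 1 / (n%:R - 2)
    & C = 1 / n%:R -> exists r : R, 0 < r /\ minimal_in_sphere g X r].
Proof.
have C0 := soliton_C_neq0 X_isometric X_soliton.
(* If n < 1/C, then s is constant, which forces 1/C = n. *)
have lo : C^-1 <= n%:R.
  rewrite leNgt; apply/negP => nC.
  have [s sE] := soliton_sqnorm_constant n_ge1 X_isometric X_soliton M_parabolic (ltW nC).
  by move: nC; rewrite (sqnorm_constant_C X_isometric X_soliton sE) ltxx.
have hi := soliton_C_bound n_ge1 X_isometric X_soliton M_parabolic.
have n0 : 0 < n%:R :> R by rewrite ltr0n.
have C_gt0 : 0 < C.
  (* For n >= 2 the bound n - 2 <= 1/C already gives C > 0; for n = 1 it gives only 1/C >= -1, and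
     the first integral for curves takes over. *)
  have [n2|n2] := leqP 2 n.
    have n2R : 2 <= n%:R :> R by rewrite ler_nat.
    have : 0 <= C^-1 by move: hi n2R; lra.
    by rewrite invr_ge0 le_eqVlt eq_sym (negPf C0).
  have n1 : n = 1%N by apply/eqP; rewrite eqn_leq n_ge1 -ltnS n2.
  subst n; exact: soliton_curve_C_gt0 X_isometric X_soliton M_parabolic.
split=> //.
- by rewrite div1r invf_ple ?posrE.
- move=> n3; have n2 : 0 < n%:R - 2 :> R by rewrite subr_gt0 ltr_nat.
  by rewrite div1r -[C]invrK lef_pV2 ?posrE ?invr_gt0 // lerBlDr.
- rewrite div1r => CE.
  have [|s sE] := soliton_sqnorm_constant n_ge1 X_isometric X_soliton M_parabolic.
    by rewrite CE invrK.
  exists (Num.sqrt s); split; last first.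
    exact: (soliton_sphere_minimal X_isometric X_soliton CE sE).
  have [p _] := manifold_nonempty S.
  by rewrite sqrtr_gt0 -(sE p) (soliton_sqnorm_gt0 X_isometric X_soliton).
Qed.
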